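(* Let $M$ be a complete $n$-dimensional smooth orientable Riemannian manifold with non-negative Ricci curvature, let $U\subset M$ be open and connected, and let $W\subset U$ be a compact set with $\overline{W^\circ}=W$. If $\{S_i\}_{i=1}^N$ is a conformal iterated function system (CIFS) on $U$ satisfying the finite type condition (FTC) with some open set $\Omega\subset W$, then $\{S_i\}_{i=1}^N$ satisfies the weak separation condition (WSC).
   Context: CIFS. Let $\Sigma=\{1,\dots,N\}$, $N\ge 2$. A map $S:U\to U$ is conformal if its derivative $S'(x)$ is a similarity (with respect to the Riemannian metric) for every $x\in U$; $|\det S'(x)|$ is computed in orthonormal bases. $\{S_i\}_{i=1}^N$ is a CIFS on $U$ (with compact set $W$) if (a) each $S_i:U\to S_i(U)\subset U$ is a conformal $C^{1+\varepsilon}$ diffeomorphism for some $\varepsilon\in(0,1)$; (b) $S_i(W)\subset W$ for all $i$; (c) $0<|\det S_i'(x)|<1$ for all $i$ and $x\in U$. WSC. For a nonempty finite word $\mathbf u=(u_1,\dots,u_k)$ over $\Sigma$ put $\mathbf u^-=(u_1,\dots,u_{k-1})$, $S_{\mathbf u}=S_{u_1}\circ\cdots\circ S_{u_k}$ and $R_{\mathbf u}=\sup_{x\in W}|\det S_{\mathbf u}'(x)|^{1/n}$ (for the empty word $S_\emptyset=\mathrm{id}$, $R_\emptyset=1$). For $0<b\le1$ let $\mathcal W_b$ be the set of nonempty words $\mathbf u$ with $R_{\mathbf u}\le b<R_{\mathbf u^-}$ and $\mathcal A_b=\{S_{\mathbf u}:\mathbf u\in\mathcal W_b\}$ (a set of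 maps). (WSC): there exist $\gamma\in\mathbb N$ and $D\subset W$ with $D^\circ\ne\emptyset$ such that $\#\{S\in\mathcal A_b: x\in S(D)\}\le\gamma$ for all $0<b\le1$, $x\in W$. Nested index sets. In this paragraph and below $\Sigma^*$ is the set of finite words over $\Sigma$, including the empty word $\emptyset$ ($S_\emptyset=\mathrm{id}$). Write $\mathbf u\preceq\mathbf v$ if $\mathbf u$ is an initial segment of $\mathbf v$ or $\mathbf u=\mathbf v$; $|\mathbf u|$ is the length. A set of words is an antichain if no two distinct elements are comparable under $\preceq$. A sequence $\{\mathcal M_k\}_{k\ge0}$ of finite subsets of $\Sigma^*$, $\mathcal M_0=\{\emptyset\}$, with $\underline m_k=\min_{\mathbf u\in\mathcal M_k}|\mathbf u|$, $\overline m_k=\max_{\mathbf u\in\mathcal M_k}|\mathbf u|$, is a sequence of nested index sets if: (a) $\{\underline m_k\}$, $\{\overline m_k\}$ are nondecreasing and tend to $\infty$; (b) each $\mathcal M_k$ is an antichain; (c) if $|\mathbf v|>\overline m_k$ there is $\mathbf u\in\mathcal M_k$ with $\mathbf u\preceq\mathbf v$; (d) if $|\mathbf v|<\underline m_k$ there is $\mathbf u\in\mathcal M_k$ with $\mathbf v\preceq\mathbf u$; (e) there is a positive integer $L$, independent of $k$, such that $|\mathbf v|-|\mathbf u|\le L$ whenever $\mathbf u\in\mathcal M_k$, $\mathbf v\in\mathcal M_{k+1}$, $\mathbf u\preceq\mathbf v$. FTC. Given nested index sets, let $\mathcal V_0=\{(\mathrm{id},0)\}$, $\mathcal V_k=\{(S_{\mathbf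 u},k):\mathbf u\in\mathcal M_k\}$ for $k\ge1$, and $\mathcal V=\bigcup_{k\ge0}\mathcal V_k$; for $\omega=(S_{\mathbf u},k)$ write $S_\omega=S_{\mathbf u}$. Let $\Omega\subset W$ be a nonempty open set invariant under $\{S_i\}$, i.e. $S_i(\Omega)\subset\Omega$ for all $i$. Vertices $\omega,\omega'\in\mathcal V_k$ are neighbors if $S_\omega(\Omega)\cap S_{\omega'}(\Omega)\ne\emptyset$; $\Omega(\omega)$ is the set of neighbors of $\omega$ (including $\omega$). For $\omega\in\mathcal V_k$, $\omega'\in\mathcal V_{k'}$ let $\tau=S_{\omega'}S_\omega^{-1}:\bigcup_{\sigma\in\Omega(\omega)}S_\sigma(W)\to W$ (it is required that this makes sense as an injective map on the whole union, given by $S_{\omega'}\circ S_\omega^{-1}$ on $S_\omega(W)$). Say $\omega\sim\omega'$ if (a) $\{S_{\sigma'}:\sigma'\in\Omega(\omega')\}=\{\tau S_\sigma:\sigma\in\Omega(\omega)\}$; and (b) for $\sigma\in\Omega(\omega)$, $\sigma'\in\Omega(\omega')$ with $S_{\sigma'}=\tau S_\sigma$, every integer $k_0\ge1$ and every $\mathbf u\in\Sigma^*$: $(S_\sigma\circ S_{\mathbf u},k+k_0)\in\mathcal V_{k+k_0}$ if and only if $(S_{\sigma'}\circ S_{\mathbf u},k'+k_0)\in\mathcal V_{k'+k_0}$. This is an equivalence relation. $\{S_i\}$ satisfies (FTC), with the open set $\Omega$, if for some sequence of nested index sets and this $\Omega$ the quotient $\mathcal V/_\sim$ is finite. *)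

(* Defs.v *)
From mathcomp Require Import all_boot all_order all_algebra finmap.
From mathcomp Require Import all_classical all_reals all_analysis.

Set Implicit Arguments.
Unset Strict Implicit.
Unset Printing Implicit Defensive.

Import Order.TTheory GRing.Theory Num.Theory numFieldNormedType.Exports.

Local Open Scope classical_set_scope.
Local Open Scope ring_scope.

Section SmoothManifolds.
Context (R : realType) (n : nat).
Notation E := 'rV[R]_n.

Definition pd (l : 'I_n) (f : E -> R) : E -> R := fun y => 'D_(delta_mx 0 l) f y.

Fixpoint Ck (k : nat) (O : set E) (f : E -> R) : Prop :=
  (forall y, O y -> {for y, continuous f}) /\
  match k with
  | 0 => True
  | k'.+1 => forall l : 'I_n,
      (forall y, O y -> derivable f y (delta_mx 0 l)) /\ Ck k' O (pd l f)
  end.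

Definition smooth_on (O : set E) (f : E -> R) : Prop := forall k, Ck k O f.

Definition smooth_map_on (O : set E) (f : E -> E) : Prop :=
  forall l : 'I_n, smooth_on O (fun y => f y 0 l).

(* [coord i] and [param i] are total functions; they are mutually inverse
   homeomorphisms between [dom i] and its image, with junk values elsewhere.
   [chart_at] fixes a preferred chart around every point. *)
Record smooth_atlas (M : topologicalType) := SmoothAtlas {
  index : Type;
  dom : index -> set M;
  coord : index -> M -> E;
  param : index -> E -> M;
  chart_at : M -> index;
  chart_atP : forall x, dom (chart_at x) x;
  dom_open : forall i, open (dom i);
  cod_open : forall i, open (coord i @` dom i);
  coordK : forall i x, dom i x -> param i (coord i x) = x;
  coord_continuous : forall i x, dom i x -> {for x, continuous (coord i)};
  param_continuous : forall i y, (coord i @` dom i) y ->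
    {for y, continuous (param i)};
  transition_smooth : forall i j,
    smooth_map_on (coord i @` (dom i `&` dom j)) (coord j \o param i)
}.

Definition atlas_compatible (M : topologicalType) (A B : smooth_atlas M) : Prop :=
  forall (i : index A) (j : index B),
    smooth_map_on (coord i @` (dom i `&` dom j)) (coord j \o param i) /\
    smooth_map_on (coord j @` (dom i `&` dom j)) (coord i \o param j).

Definition oriented_atlas (M : topologicalType) (B : smooth_atlas M) : Prop :=
  forall (i j : index B) y, (coord i @` (dom i `&` dom j)) y ->
    0 < \det ('J (coord j \o param i) y).

Definition orientable (M : topologicalType) (A : smooth_atlas M) : Prop :=
  exists B : smooth_atlas M, atlas_compatible A B /\ oriented_atlas B.

(* Tangent vectors are row vectors, on which Jacobian matrices act from the
   right. *)
Record riemannian_metric (M : topologicalType) (A : smooth_atlas M) :=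
  RiemannianMetric {
  gram : index A -> E -> 'M[R]_n;
  gram_sym : forall i y, (coord i @` dom i) y -> (gram i y)^T = gram i y;
  gram_pos : forall i y, (coord i @` dom i) y -> forall v : E, v != 0 ->
    0 < (v *m gram i y *m v^T) 0 0;
  gram_smooth : forall i (a b : 'I_n),
    smooth_on (coord i @` dom i) (fun y => gram i y a b);
  gram_transition : forall i j y, (coord i @` (dom i `&` dom j)) y ->
    let J := 'J (coord j \o param i) y in
    gram i y = J *m gram j (coord j (param i y)) *m J^T
}.

Section Riemannian.
Context (M : topologicalType) (A : smooth_atlas M) (g : riemannian_metric A).

Definition christoffel (i : index A) (k a b : 'I_n) (y : E) : R :=
  2^-1 * \sum_(l < n) invmx (gram g i y) k l *
    (pd a (fun z => gram g i z b l) y + pd b (fun z => gram g i z a l) y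
     - pd l (fun z => gram g i z a b) y).

Definition ricci (i : index A) (y : E) : 'M[R]_n := \matrix_(a, b)
  (\sum_(l < n) (pd l (christoffel i l a b) y - pd b (christoffel i l a l) y)
   + \sum_(l < n) \sum_(m < n)
      (christoffel i m a b y * christoffel i l l m y
       - christoffel i m a l y * christoffel i l b m y)).

Definition nonneg_ricci : Prop :=
  forall i y, (coord i @` dom i) y -> forall v : E,
    0 <= (v *m ricci i y *m v^T) 0 0.

Definition gram_at (x : M) : 'M[R]_n :=
  gram g (chart_at A x) (coord (chart_at A x) x).

Definition tnorm (x : M) (v : E) : R := Num.sqrt ((v *m gram_at x *m v^T) 0 0).

Definition C1_curve (c : R -> M) : Prop :=
  forall t : R, 0 <= t <= 1 ->
    let c' := coord (chart_at A (c t)) \o c in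
    {for t, continuous c} /\
    \forall s \near t, derivable c' s 1 /\ {for s, continuous (derive1 c')}.

Definition speed (c : R -> M) (t : R) : R :=
  tnorm (c t) (derive1 (coord (chart_at A (c t)) \o c) t).

Definition curve_length (c : R -> M) : \bar R :=
  (\int[lebesgue_measure]_(t in `[0%R, 1%R]) (speed c t)%:E)%E.

(* [path_length x y l]: some piecewise C^1 path from x to y has length l. *)
Inductive path_length : M -> M -> \bar R -> Prop :=
| path_nil x : path_length x x 0%E
| path_cons c y l : C1_curve c -> path_length (c 1) y l ->
    path_length (c 0) y (curve_length c + l)%E.

Definition rdist (x y : M) : \bar R := ereal_inf [set l | path_length x y l].

Definition complete_metric : Prop :=
  forall u : nat -> M,
    (forall e : R, 0 < e -> exists K : nat, forall p q : nat,
      (K <= p)%N -> (K <= q)%N -> (rdist (u p) (u q) < e%:E)%E) ->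
    exists x : M, u @ \oo --> x.

Definition in_charts (f : M -> M) (x : M) : E -> E :=
  coord (chart_at A (f x)) \o f \o param (chart_at A x).

Definition dmap (f : M -> M) (x : M) : 'M[R]_n :=
  'J (in_charts f x) (coord (chart_at A x) x).

(* C^{1+e} on an open set: the derivative, read in charts, is locally
   e-Hoelder; this does not depend on the charts. *)
Definition C1_holder (e : R) (O : set M) (f : M -> M) : Prop :=
  forall x, O x ->
    {for x, continuous f} /\
    exists2 B : set E, nbhs (coord (chart_at A x) x) B &
      (forall y, B y -> differentiable (in_charts f x) y) /\
      exists C : R, forall y z, B y -> B z ->
        `|'J (in_charts f x) y - 'J (in_charts f x) z| <= C * `|y - z| `^ e.

Definition C1_holder_diffeo (e : R) (O : set M) (f : M -> M) : Prop :=
  [/\ C1_holder e O f, open (f @` O) &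
      exists h : M -> M, (forall x, O x -> h (f x) = x) /\
        C1_holder e (f @` O) h].

Definition conformal_on (O : set M) (f : M -> M) : Prop :=
  forall x, O x -> exists2 r : R, 0 < r &
    forall v : E, tnorm (f x) (v *m dmap f x) = r * tnorm x v.

(* |det f'(x)| in orthonormal bases, see [absdet_orthonormal]. *)
Definition absdet (f : M -> M) (x : M) : R :=
  `|\det (dmap f x)| * Num.sqrt (\det (gram_at (f x))) /
    Num.sqrt (\det (gram_at x)).

(* The rows of P and Q are orthonormal bases at x and f x, and D is the matrix
   of the derivative in these bases. *)
Lemma absdet_orthonormal (f : M -> M) (x : M) (P Q D : 'M[R]_n) :
  P *m gram_at x *m P^T = 1%:M ->
  Q *m gram_at (f x) *m Q^T = 1%:M ->
  P *m dmap f x = D *m Q ->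
  absdet f x = `|\det D|.
Proof.
have key (X G : 'M[R]_n) : X *m G *m X^T = 1%:M ->
    \det X != 0 /\ Num.sqrt (\det G) = `|\det X|^-1.
  move=> /(congr1 determinant); rewrite !det_mulmx det_tr det1 => h.
  have X0 : \det X != 0.
    by apply: contra_eq_neq h => ->; rewrite mul0r mul0r eq_sym oner_neq0.
  split=> //; have -> : \det G = ((\det X)^-1) ^+ 2.
    by rewrite -[LHS](mulKf X0) -[X in _^-1 * X](mulfK X0) h mul1r expr2.
  by rewrite sqrtr_sqr normfV.
move=> /key[P0 hP] /key[Q0 hQ] /(congr1 determinant).
rewrite !det_mulmx /absdet hP hQ invrK => h.
by rewrite -!normfV -!normrM mulrAC [_ * \det P]mulrC h mulfK.
Qed.

End Riemannian.
End SmoothManifolds.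

Section IteratedFunctionSystems.
Context (R : realType) (n : nat) (M : topologicalType).
Context (A : smooth_atlas R n M) (g : riemannian_metric A).
Context (N : nat) (U W : set M) (S : 'I_N -> M -> M).

Notation word := (seq 'I_N).

Definition cifs : Prop :=
  [/\ forall i, [/\ S i @` U `<=` U, conformal_on g U (S i) &
        exists2 e : R, 0 < e < 1 & C1_holder_diffeo A e U (S i)],
      forall i, S i @` W `<=` W &
      forall i x, U x -> 0 < absdet g (S i) x < 1].

Definition word_map (u : word) : M -> M := foldr (fun i f => S i \o f) id u.

(* Maps W -> W are represented by maps M -> M equal to the identity off W, so
   that Leibniz equality is equality on W. *)
Definition on_W (f : M -> M) : M -> M := patch id W f.

Definition map_of (u : word) : M -> M := on_W (word_map u).

Definition ratio (u : word) : R :=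
  if u is [::] then 1
  else sup [set absdet g (word_map u) x `^ n%:R^-1 | x in W].

(* [rcons v i] is the word with u^- = v. *)
Definition words_at (b : R) : set word :=
  [set u | exists v i, u = rcons v i /\ ratio u <= b < ratio v].

Definition maps_at (b : R) : set (M -> M) := map_of @` words_at b.

Definition wsc : Prop :=
  exists (gamma : nat) (D : set M), [/\ D `<=` W, interior D !=set0 &
    forall b : R, 0 < b <= 1 -> forall x, W x ->
      ([set f | maps_at b f /\ (f @` D) x] #<= `I_gamma)%card].

Definition max_len (K : {fset word}) : nat := \max_(u <- K) size u.

Definition min_len (K : {fset word}) : nat :=
  \big[minn/max_len K]_(u <- K) size u.

Record nested_index_sets (K : nat -> {fset word}) : Prop := {
  nested0 : K 0%N = [fset [::]]%fset;
  nested_min_homo : {homo (fun k => min_len (K k)) : k l / (k <= l)%N};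
  nested_max_homo : {homo (fun k => max_len (K k)) : k l / (k <= l)%N};
  nested_min_oo : (fun k => min_len (K k)) @ \oo --> \oo;
  nested_max_oo : (fun k => max_len (K k)) @ \oo --> \oo;
  nested_antichain : forall k u v, u \in K k -> v \in K k -> prefix u v -> u = v;
  nested_above : forall k v, (max_len (K k) < size v)%N ->
    exists2 u, u \in K k & prefix u v;
  nested_below : forall k v, (size v < min_len (K k))%N ->
    exists2 u, u \in K k & prefix v u;
  nested_gap : exists2 L : nat, (0 < L)%N & forall k u v,
    u \in K k -> v \in K k.+1 -> prefix u v -> (size v - size u <= L)%N
}.

Section FiniteType.
Context (Omega : set M) (K : nat -> {fset word}).

(* Vertices are pairs (f, k); the level 0 is {(id, 0)} because K 0 only
   contains the empty word. *)
Definition vertices : set ((M -> M) * nat) :=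
  [set w | exists2 u, u \in K w.2 & w.1 = map_of u].

(* The maps of the neighbors of w, all of which have the level of w. *)
Definition neighbor_maps (w : (M -> M) * nat) : set (M -> M) :=
  [set f | vertices (f, w.2) /\ (w.1 @` Omega) `&` (f @` Omega) !=set0].

(* The values of tau outside the union are junk.  On the union tau is an
   injection into W that extends w'.1 \o w.1^-1, the map it has to be on
   w.1 @` W. *)
Definition vertex_equiv (w w' : (M -> M) * nat) : Prop :=
  exists tau : M -> M,
    [/\ set_inj (\bigcup_(f in neighbor_maps w) (f @` W)) tau,
        tau @` (\bigcup_(f in neighbor_maps w) (f @` W)) `<=` W,
        forall x, W x -> tau (w.1 x) = w'.1 x,
        neighbor_maps w' = [set on_W (tau \o f) | f in neighbor_maps w] &
        forall f f', neighbor_maps w f -> neighbor_maps w' f' ->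
          f' = on_W (tau \o f) ->
          forall (k0 : nat) (u : word), (0 < k0)%N ->
            vertices (on_W (f \o word_map u), (w.2 + k0)%N) <->
            vertices (on_W (f' \o word_map u), (w'.2 + k0)%N)].

Definition vertex_class (w : (M -> M) * nat) : set ((M -> M) * nat) :=
  [set w' | vertices w' /\ vertex_equiv w w'].

End FiniteType.

Definition ftc (Omega : set M) : Prop :=
  [/\ open Omega, Omega !=set0, Omega `<=` W,
      forall i, S i @` Omega `<=` Omega &
      exists K : nat -> {fset word}, nested_index_sets K /\
        finite_set [set vertex_class Omega K w | w in vertices K]].

End IteratedFunctionSystems.

(* Main.v *)
(* The two ingredients are bounded distortion on [W] and the counting of maps by
   neighborhood types.

   Bounded distortion: let F be the set of functions on [U] whose infinitesimal
   slope is at most 1 and let d(x, y) be the supremum of |f x - f y| over F, a dual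
   form of the inner distance of [U].  It is finite because [U] is connected.  If f
   is in F then so is f o S_i, and near a point x of [W], where S_i contracts by
   some r < 1, there is room to add (1 - r) times a bump function centred at x.
   Hence d(S_i x, S_i y) <= d(x, y) - c * bump(x, y) for all x, y in [W], however
   far apart, and as d is bounded by a multiple of the bump on [W], every S_i
   contracts d on [W] by one factor t < 1.  The logarithm of |det S_i'| is Hoelder
   with respect to d, so its oscillations along an orbit sum to a geometric series.

   Counting: take D := [Omega].  Let S_u, S_u1 in A_b with x in S_u(D) and S_u1(D),
   and let w, w1 be prefixes of u, u1 in one index set M_k.  Then S_w and S_w1 are
   neighbors, and the equivalence with one of finitely many vertices preserves the
   quotient of their Jacobians over x exactly; so these are comparable.  Since R_u
   and R_u1 are both of the order of b, bounded distortion yields a bound for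
   |u| - |w| once |u1| - |w1| is bounded.  Thus S_u is determined by the neighbor S_w
   and a word of bounded length. *)
From Pilot Require Import Defs.
From mathcomp Require Import all_boot all_order all_algebra finmap.
From mathcomp Require Import all_classical all_reals all_analysis.
From mathcomp Require Import ring lra.

Import Order.TTheory GRing.Theory Num.Theory numFieldNormedType.Exports.
Import Pilot.Defs.
Local Open Scope classical_set_scope.
Local Open Scope ring_scope.
Set Implicit Arguments.
Unset Strict Implicit.
Unset Printing Implicit Defensive.

(** * Calculus on row vectors *)

(** The mean value inequality for functions that need not be derivable. With slack [e], the supremum
    [c] of the times up to which the bound holds inherits the bound from the left and, by the local
    estimate at [c], passes it on to the right, so [c = 1]. *)
Lemma slope_segment (R : realType) (g : R -> R) (L : R) :
  (forall t : R, 0 <= t <= 1 -> forall e : R, 0 < e ->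
     \forall s \near t, `|g s - g t| <= (L + e) * `|s - t|) ->
  `|g 1 - g 0| <= L.
Proof.
move=> gL; apply/ler_addgt0Pr => e e0.
set K := L + e.
pose S := [set t : R | 0 <= t <= 1 /\
  forall s, 0 <= s <= t -> `|g s - g 0| <= K * s].
have S0 : S 0.
  split=> [|s]; first by rewrite lexx ler01.
  by rewrite -eq_le => /eqP <-; rewrite subrr normr0 mulr0.
have Sub : has_sup S by split; [exists 0 | exists 1 => t [/andP[]]].
pose c := sup S.
have c0 : 0 <= c by apply: ub_le_sup S0; case: Sub.
have c1 : c <= 1 by apply: ge_sup; [exists 0 | move=> t [/andP[]]].
have Slt s : 0 <= s < c -> `|g s - g 0| <= K * s.
  move=> /andP[s0 sc].
  have [t [_ tS] st] : exists2 t, S t & s < t.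
    by have := sup_gt (ex_intro _ _ S0) sc; case=> t St st; exists t.
  by apply: tS; rewrite s0 ltW.
have /nbhs_ballP[d /= d0 dP] : \forall s \near c, `|g s - g c| <= K * `|s - c|.
  by apply: gL => //; rewrite c0.
have gc : `|g c - g 0| <= K * c.
  have [->|cN0] := eqVneq c 0; first by rewrite subrr normr0 mulr0.
  pose t := Num.max 0 (c - d / 2).
  have tc : t < c by rewrite gt_max lt_neqAle eq_sym cN0 c0 /=; lra.
  have t0 : 0 <= t by rewrite le_max lexx.
  have dt : c - d / 2 <= t by rewrite le_max lexx orbT.
  have /Slt gt : 0 <= t < c by rewrite t0.
  have /dP : ball c d t.
    by rewrite /ball /= ger0_norm ?subr_ge0 ?(ltW tc)//; lra.
  rewrite distrC (distrC t) (@ger0_norm _ (c - t)) ?subr_ge0 ?(ltW tc)// => gct.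
  have h := ler_distD (g t) (g c) (g 0); move: h gct gt; rewrite mulrBr; lra.
have Sc t : 0 <= t <= 1 -> t < c + d -> S t.
  move=> /andP[t0 t1] tcd; split=> [|s /andP[s0 st]]; first by rewrite t0.
  have [sc|cs] := ltP s c; first by apply: Slt; rewrite s0.
  have /dP : ball c d s.
    by rewrite /ball /= distrC ger0_norm ?subr_ge0//; lra.
  rewrite (@ger0_norm _ (s - c)) ?subr_ge0// => gct.
  have h := ler_distD (g c) (g s) (g 0); move: h gct gc; rewrite mulrBr; lra.
have c1E : c = 1.
  apply/eqP; rewrite eq_le c1 leNgt; apply/negP => cl1.
  pose t := Num.min 1 (c + d / 2).
  have /(ub_le_sup Sub.2) : S t.
    apply: Sc; last by rewrite gt_min; apply/orP; right; lra.
    by rewrite ge_min lexx le_min ler01 /=; lra.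
  by rewrite -/c leNgt /t lt_min cl1 /=; lra.
by move: gc; rewrite c1E mulr1.
Qed.

Section MatrixNorm.
Context (R : realType).

Lemma mx_norm_le m n (A : 'M[R]_(m, n)) c :
  0 <= c -> (`|A| <= c) <-> (forall i j, `|A i j| <= c).
Proof.
move=> c0; split=> [Ac i j|Ac].
  apply: le_trans Ac; rewrite [leRHS]/Num.Def.normr /= mx_normrE.
  exact: (le_bigmax _ (fun k : 'I_m * 'I_n => `|A k.1 k.2|) (i, j)).
by rewrite /Num.Def.normr /= mx_normrE; apply/bigmax_leP; split=> // -[i j] _; apply: Ac.
Qed.

Lemma entry_le_norm m n (A : 'M[R]_(m, n)) i j : `|A i j| <= `|A|.
Proof. exact: (mx_norm_le A (normr_ge0 A)).1. Qed.

Lemma mulmx_norm_le m n p (A : 'M[R]_(m, n)) (B : 'M[R]_(n, p)) :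
  `|A *m B| <= n%:R * `|A| * `|B|.
Proof.
apply/mx_norm_le => [|i j]; first by rewrite !mulr_ge0.
rewrite mxE (le_trans (ler_norm_sum _ _ _))//.
have -> : n%:R * `|A| * `|B| = \sum_(k < n) `|A| * `|B|.
  by rewrite sumr_const card_ord -mulrA mulr_natl.
by apply: ler_sum => k _; rewrite normrM ler_pM ?entry_le_norm.
Qed.

End MatrixNorm.

(** * Derivatives as matrices acting on row vectors *)

Section Jacobian.
Context (R : realType).

(* [z - y] is a row vector, so [J] is the matrix of the derivative acting from
   the right, as in [jacobian]. *)
Definition has_jacobian m n (f : 'rV[R]_m -> 'rV[R]_n) y (J : 'M[R]_(m, n)) :=
  forall e : R, 0 < e -> \forall z \near y,
    `|f z - f y - (z - y) *m J| <= e * `|z - y|.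

Lemma mulmxr_continuous m n (J : 'M[R]_(m, n)) :
  continuous (mulmxr J : 'rV[R]_m -> 'rV[R]_n).
Proof.
move=> x; apply/(@cvgrPdist_le _ _ _ (nbhs x) (nbhs_filter x)) => e e0.
pose c := m%:R * `|J| + 1.
have c0 : 0 < c by rewrite ltr_wpDl ?mulr_ge0.
near=> y; rewrite /= -mulmxBl (le_trans (mulmx_norm_le _ _))//.
have xy : `|x - y| <= e / c.
  by near: y; apply: cvgr_dist_le; [exact: cvg_id|rewrite divr_gt0].
rewrite -(divfK (lt0r_neq0 c0) e) mulrAC [leRHS]mulrC.
by apply: ler_pM => //; rewrite /c lerDl.
Unshelve. all: by end_near. Qed.

Lemma near_subr0 (V : normedModType R) (y : V) (P : V -> Prop) :
  (\forall h \near 0, P h) <-> (\forall z \near y, P (z - y)).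
Proof. by rewrite (near_shift y 0) sub0r. Qed.

Lemma has_jacobianP m n (f : 'rV[R]_m -> 'rV[R]_n) y J :
  has_jacobian f y J <-> differentiable f y /\ 'J f y = J.
Proof.
have near0 (P : 'rV[R]_m -> Prop) := near_subr0 y P.
split=> [fJ|[df <-]].
  pose df : {linear 'rV[R]_m -> 'rV[R]_n} := mulmxr J.
  have eqf : f \o shift y = cst (f y) + df +o_ (0 : 'rV[R]_m) id.
    apply/eqaddoP => e e0.
    apply/near0; have := fJ e e0; apply: filterS => z.
    by rewrite /= !fctE /= subrK opprD addrA.
  have dfc : continuous df by exact: mulmxr_continuous.
  have dfE : 'd f y = df :> (_ -> _) by apply: diff_unique.
  split; first by apply/diff_locallyP; rewrite dfE.
  apply/row_matrixP => i; rewrite !rowE /jacobian mul_rV_lin1 /= dfE.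
  by [].
move=> e e0.
have /eqaddoP/(_ e e0) := diff_locally df.
move=> /near0; apply: filterS => z.
by rewrite !fctE /= subrK opprD addrA /jacobian mul_rV_lin1.
Qed.

Lemma near_has_jacobian m n (f h : 'rV[R]_m -> 'rV[R]_n) y J :
  (\forall z \near y, f z = h z) -> has_jacobian f y J -> has_jacobian h y J.
Proof.
move=> fh fJ e e0; have fhy := nbhs_singleton fh.
near=> z; have <- : f z = h z by near: z.
by rewrite -fhy; near: z; exact: fJ.
Unshelve. all: by end_near. Qed.

Lemma has_jacobian_id n (y : 'rV[R]_n) : has_jacobian id y 1%:M.
Proof.
by move=> e e0; near=> z; rewrite mulmx1 subrr normr0 mulr_ge0 // ltW.
Unshelve. all: by end_near. Qed.

Lemma has_jacobian_lip m n (f : 'rV[R]_m -> 'rV[R]_n) y J :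
  has_jacobian f y J ->
  \forall z \near y, `|f z - f y| <= (m%:R * `|J| + 1) * `|z - y|.
Proof.
move=> /(_ 1 ltr01); apply: filterS => z; rewrite mul1r => fz.
rewrite -(subrK ((z - y) *m J) (f z - f y)) (le_trans (ler_normD _ _))//.
by rewrite mulrDl mul1r addrC lerD// mulrAC mulmx_norm_le.
Qed.

Lemma has_jacobian_continuous m n (f : 'rV[R]_m -> 'rV[R]_n) y J :
  has_jacobian f y J -> {for y, continuous f}.
Proof. by move=> /has_jacobianP[/differentiable_continuous]. Qed.

Lemma has_jacobian_comp m n p (f : 'rV[R]_m -> 'rV[R]_n)
    (h : 'rV[R]_n -> 'rV[R]_p) y J J' :
  has_jacobian f y J -> has_jacobian h (f y) J' ->
  has_jacobian (h \o f) y (J *m J').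
Proof.
move=> fJ hJ e e0.
pose c := m%:R * `|J| + 1; pose c' := n%:R * `|J'| + 1.
have c0 : 0 < c by rewrite ltr_wpDl ?mulr_ge0.
have c'0 : 0 < c' by rewrite ltr_wpDl ?mulr_ge0.
have e1 : 0 < e / 2 / c by rewrite !divr_gt0.
have e2 : 0 < e / 2 / c' by rewrite !divr_gt0.
have fc := has_jacobian_continuous fJ.
near=> z.
have h1 : `|h (f z) - h (f y) - (f z - f y) *m J'| <= e / 2 / c * `|f z - f y|.
  near: z.
  exact: (fc _ (hJ _ e1)).
have f1 : `|f z - f y| <= c * `|z - y|.
  by near: z; exact: has_jacobian_lip.
have f2 : `|f z - f y - (z - y) *m J| <= e / 2 / c' * `|z - y|.
  by near: z; exact: fJ.
have -> : (h \o f) z - (h \o f) y - (z - y) *m (J *m J') =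
    (h (f z) - h (f y) - (f z - f y) *m J') + (f z - f y - (z - y) *m J) *m J'.
  by rewrite [X in _ = _ + X]mulmxBl mulmxA addrA subrK.
rewrite (le_trans (ler_normD _ _))// (splitr e) mulrDl lerD//.
  apply: (le_trans h1); apply: le_trans (ler_wpM2l (ltW e1) f1) _.
  by rewrite mulrA divfK ?gt_eqF.
rewrite (le_trans (mulmx_norm_le _ _))//.
apply: le_trans (_ : c' * (e / 2 / c' * `|z - y|) <= _); last first.
  by rewrite mulrA (mulrC c') divfK ?gt_eqF.
rewrite mulrAC ler_pM ?mulr_ge0//.
by rewrite /c' lerDl.
Unshelve. all: by end_near. Qed.

End Jacobian.

Lemma near_forall_ord (T : Type) (n : nat) (F : set_system T) (P : 'I_n -> T -> Prop) :
  Filter F -> (forall l, \forall z \near F, P l z) ->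
  \forall z \near F, forall l, P l z.
Proof. exact: (@filter_forall _ _ P). Qed.

Lemma mx_norm_lt (R : realType) m n (A : 'M[R]_(m, n)) c :
  0 < c -> (`|A| < c) <-> (forall i j, `|A i j| < c).
Proof.
move=> c0; rewrite [X in X < c]/Num.Def.normr /= mx_normrE.
split=> [/bigmax_ltP[_ Ac] i j|Ac]; first exact: (Ac (i, j)).
by apply/bigmax_ltP; split=> // -[i j] _; apply: Ac.
Qed.

(** * Partial derivatives and first-order Taylor estimates *)

Section PartialDerivatives.
Context (R : realType) (n : nat).
Notation E := 'rV[R]_n.

Lemma ball_rowP (y z : E) (s : R) : 0 < s ->
  ball y s z <-> forall l, `|y 0 l - z 0 l| < s.
Proof.
move=> s0; rewrite mx_norm_ball /ball_ /= (mx_norm_lt _ s0).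
by split=> [yz l|yz i l]; [have := yz 0 l|rewrite (ord1 i)]; rewrite !mxE.
Qed.

Lemma convex_dist_lt (y a b t s : R) : 0 <= t <= 1 ->
  `|y - a| < s -> `|y - b| < s -> `|y - (a + t * (b - a))| < s.
Proof.
move=> /andP[t0 t1] ya yb.
have -> : y - (a + t * (b - a)) = (1 - t) * (y - a) + t * (y - b) by lra.
have ms : Num.max `|y - a| `|y - b| < s by rewrite gt_max ya.
apply: le_lt_trans ms; rewrite (le_trans (ler_normD _ _))// !normrM.
rewrite (ger0_norm t0) ger0_norm ?subr_ge0//.
set m := Num.max _ _; have am : `|y - a| <= m by rewrite le_max lexx.
have bm : `|y - b| <= m by rewrite le_max lexx orbT.
have -> : m = (1 - t) * m + t * m by lra.
by rewrite lerD// ler_wpM2l// subr_ge0.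
Qed.

(** Subtracting the linear term [t * h * c] leaves a function of [t] whose slope is at most [C]
    times the absolute value of [h], so [slope_segment] applies. *)
Lemma partial_slope (f : E -> R) (l : 'I_n) (a : E) (h c C : R) :
  (forall t, 0 <= t <= 1 -> let z := a + (t * h) *: delta_mx 0 l in
     derivable f z (delta_mx 0 l) /\ `|pd l f z - c| <= C) ->
  `|f (a + h *: delta_mx 0 l) - f a - h * c| <= C * `|h|.
Proof.
move=> fd; set d := delta_mx 0 l.
pose g (t : R) := f (a + (t * h) *: d) - t * h * c.
have -> : f (a + h *: d) - f a - h * c = g 1 - g 0.
  by rewrite /g !mul1r !mul0r scale0r addr0 subr0; lra.
apply: slope_segment => t t01 e e0.
have [fdt fC] := fd t t01; rewrite -/d in fdt fC; set z := a + _ in fdt fC.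
have h1 : 0 < `|h| + 1 by rewrite ltr_wpDl.
have /eqaddoP/(_ (e / (`|h| + 1)) (divr_gt0 e0 h1)) := derivable_nbhs fdt.
move=> /(near_subr0 t) H.
have ch : (fun s : R => (s - t) * h + t) @ t --> t.
  have : (fun s : R => (s - t) * h + t) @ t --> (t - t) * h + t.
    by apply: cvgD; [apply: cvgMl; apply: cvgB; [exact: cvg_id|exact: cvg_cst]|
       exact: cvg_cst].
  by rewrite subrr mul0r add0r.
have H2 : \forall s \near t, `|f ((s - t) * h *: d + z) - f z
    - (s - t) * h * pd l f z| <= e / (`|h| + 1) * `|(s - t) * h|.
  have H1 : nbhs t [set s | `|((fun k : R => (f \o shift z) (k *: d)) -
     (cst (f z) + *:%R^~ ('D_d f z))) ((s - t) * h + t - t)|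
      <= e / (`|h| + 1) * `|(s - t) * h + t - t|] := ch _ H.
  by apply: filterS H1 => s /=; rewrite !fctE /= addrK opprD addrA.
near=> s; have : `|f ((s - t) * h *: d + z) - f z - (s - t) * h * pd l f z|
    <= e / (`|h| + 1) * `|(s - t) * h| by near: s.
have -> : (s - t) * h *: d + z = a + (s * h) *: d.
  by rewrite /z addrCA -scalerDl; congr (a + _ *: d); lra.
move=> H1.
have -> : g s - g t = (f (a + (s * h) *: d) - f z - (s - t) * h * pd l f z)
   + (s - t) * h * (pd l f z - c) by rewrite /g -/z; lra.
rewrite (le_trans (ler_normD _ _))// [leLHS]addrC [leRHS]mulrDl lerD//.
  by rewrite normrM normrM mulrC (mulrC _ `|h|) mulrA ler_wpM2r// ler_wpM2r.
apply: (le_trans H1); rewrite normrM mulrCA mulrC ler_wpM2r//.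
by rewrite -mulrA ler_piMr ?(ltW e0)// mulrC ler_pdivrMr// mul1r lerDl.
Unshelve. all: by end_near. Qed.

(** The passage from [a] to [b] changes one coordinate at a time, and [partial_slope] handles each
    change. The intermediate points stay in the ball because balls of the maximum norm are cubes. *)
Lemma partials_taylor (f : E -> R) (y : E) (s C : R) (c : 'I_n -> R) :
  (forall z, ball y s z -> forall l,
     derivable f z (delta_mx 0 l) /\ `|pd l f z - c l| <= C) ->
  forall a b, ball y s a -> ball y s b ->
  `|f b - f a - \sum_l (b 0 l - a 0 l) * c l| <= n%:R * C * `|b - a|.
Proof.
move=> fd a b ya yb.
have s0 : 0 < s by case: ya.
pose mix k : E := \row_l (if (l < k)%N then b 0 l else a 0 l).
have mixS (l : 'I_n) : mix l.+1 = mix l + (b 0 l - a 0 l) *: delta_mx 0 l.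
  apply/rowP => j; rewrite !mxE eqxx /= ltnS leq_eqVlt.
  case: (eqVneq j l) => [->|jl]; first by rewrite eqxx ltnn /=; lra.
  by rewrite mulr0 addr0 [X in X || _](negPf jl).
have -> : f b - f a = \sum_(l < n) (f (mix l.+1) - f (mix l)).
  rewrite -(big_mkord xpredT (fun l => f (mix l.+1) - f (mix l))) telescope_sumr//.
  congr (f _ - f _); apply/rowP => j; rewrite !mxE ?ltn0 ?ltn_ord//.
rewrite -sumrB (le_trans (ler_norm_sum _ _ _))//.
have -> : n%:R * C * `|b - a| = \sum_(l < n) C * `|b - a|.
  by rewrite sumr_const card_ord -mulrA mulr_natl.
apply: ler_sum => l _; rewrite mixS.
have C0 : 0 <= C by have [_] := fd y (ballxx _ s0) l; apply: le_trans.
apply: le_trans (_ : C * `|b 0 l - a 0 l| <= _); last first.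
  by rewrite ler_wpM2l//; have := entry_le_norm (b - a) 0 l; rewrite !mxE.
apply: partial_slope => t t01; apply: fd.
apply/ball_rowP => // j; rewrite !mxE eqxx /=.
have /(ball_rowP _ _ s0)/(_ j) := ya; have /(ball_rowP _ _ s0)/(_ j) := yb.
case: (eqVneq j l) => [->|jl]; last by rewrite mulr0 addr0; case: ifP.
rewrite ltnn mulr1 => bs as_; exact: convex_dist_lt.
Qed.

(** Strict differentiability: both endpoints vary near [y], which is what the local Lipschitz bound
    [Ck1_lipschitz] rests on. *)
Lemma Ck1_taylor (O : set E) (f : E -> R) (y : E) : open O -> O y -> Ck 1 O f ->
  forall e : R, 0 < e -> exists2 s, 0 < s & forall a b, ball y s a -> ball y s b ->
  `|f b - f a - \sum_l (b 0 l - a 0 l) * pd l f y| <= e * `|b - a|.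
Proof.
move=> Oo Oy [_ fd] e e0; pose C := e / (n%:R + 1).
have C0 : 0 < C by rewrite divr_gt0// ltr_wpDl.
have : \forall z \near y, O z /\ forall l, `|pd l f z - pd l f y| <= C.
  apply: filterI; first exact: open_nbhs_nbhs.
  apply: (near_forall_ord (nbhs_filter y)) => l.
  have [_ [+ _]] := fd l => /(_ _ Oy) pdc.
  exact: (@cvgr_distC_le _ _ _ _ (nbhs_filter y) _ _ pdc _ C0).
move=> /nbhs_ballP[s /= s0 sP]; exists s => // a b ya yb.
have := @partials_taylor f y s C (fun l => pd l f y) _ a b ya yb.
move=> /(_ _)/le_trans; apply.
  move=> z /sP[Oz zC] l; split; last exact: zC.
  by have [+ _] := fd l; apply.
rewrite ler_wpM2r// /C mulrA ler_pdivrMr ?ltr_wpDl// mulrC ler_wpM2l ?(ltW e0)//.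
by rewrite lerDl.
Qed.

Lemma Ck1_lipschitz (O : set E) (f : E -> R) (y : E) :
  open O -> O y -> Ck 1 O f ->
  exists2 s : R, 0 < s & exists C : R, forall a b, ball y s a -> ball y s b ->
  `|f b - f a| <= C * `|b - a|.
Proof.
move=> Oo Oy fC; have [s s0 sP] := Ck1_taylor Oo Oy fC ltr01.
exists s => //; exists (1 + \sum_l `|pd l f y|) => a b ya yb.
have := sP a b ya yb; set S := \sum_l _ => H.
rewrite -(subrK S (f b - f a)) (le_trans (ler_normD _ _))// mulrDl lerD//.
rewrite (le_trans (ler_norm_sum _ _ _))// mulr_suml ler_sum// => l _.
rewrite normrM mulrC ler_wpM2l//.
by have := entry_le_norm (b - a) 0 l; rewrite !mxE.
Qed.

Lemma smooth_map_differentiable (O : set E) (f : E -> E) (y : E) :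
  open O -> O y -> smooth_map_on O f -> differentiable f y.
Proof.
move=> Oo Oy fs.
pose J : 'M[R]_n := \matrix_(k, l) pd k (fun y => f y 0 l) y.
suff /has_jacobianP[] : has_jacobian f y J by [].
move=> e e0.
have : \forall z \near y, forall l, `|f z 0 l - f y 0 l
    - \sum_k (z 0 k - y 0 k) * pd k (fun y => f y 0 l) y| <= e * `|z - y|.
  apply: (near_forall_ord (nbhs_filter y)) => l; have [s s0 sP] := Ck1_taylor Oo Oy (fs l 1%N) e0.
  by near=> z; apply: sP; [exact: ballxx|near: z; exact: nbhsx_ballx].
apply: filterS => z zP; apply/mx_norm_le; first by rewrite mulr_ge0// ltW.
move=> i l; rewrite (ord1 i) !mxE; have := zP l.
by under [in X in _ -> X]eq_bigr => k _ do rewrite !mxE.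
Unshelve. all: by end_near. Qed.

End PartialDerivatives.

(** * Positive definite forms *)

Section PositiveForms.
Context (R : realType) (n : nat).
Notation E := 'rV[R]_n.

Definition bil (G : 'M[R]_n) (u v : E) : R := (u *m G *m v^T) 0 0.

Definition posdef (G : 'M[R]_n) : Prop :=
  G^T = G /\ forall v : E, v != 0 -> 0 < bil G v v.

Definition qnorm (G : 'M[R]_n) (v : E) : R := Num.sqrt (bil G v v).

Implicit Types (G : 'M[R]_n) (u v : E).

Lemma bilDl G u u' v : bil G (u + u') v = bil G u v + bil G u' v.
Proof. by rewrite /bil !mulmxDl mxE. Qed.

Lemma bilDr G u v v' : bil G u (v + v') = bil G u v + bil G u v'.
Proof. by rewrite /bil linearD mulmxDr mxE. Qed.

Lemma bilZl G (a : R) u v : bil G (a *: u) v = a * bil G u v.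
Proof. by rewrite /bil -!scalemxAl mxE. Qed.

Lemma bilZr G (a : R) u v : bil G u (a *: v) = a * bil G u v.
Proof. by rewrite /bil linearZ -scalemxAr mxE. Qed.

Lemma bilC G u v : G^T = G -> bil G u v = bil G v u.
Proof.
move=> GT; rewrite /bil; have -> : v *m G *m u^T = (u *m G *m v^T)^T.
  by rewrite !trmx_mul trmxK GT mulmxA.
by rewrite [RHS]mxE.
Qed.

Lemma bil0 G u : bil G 0 u = 0.
Proof. by rewrite /bil !mul0mx mxE. Qed.

Lemma bil_ge0 G v : posdef G -> 0 <= bil G v v.
Proof. by move=> [_ Gp]; case: (eqVneq v 0) => [->|/Gp/ltW//]; rewrite bil0. Qed.

Lemma qnorm_sqr G v : posdef G -> qnorm G v ^+ 2 = bil G v v.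
Proof. by move=> Gp; rewrite sqr_sqrtr ?bil_ge0. Qed.

Lemma qnorm_ge0 G v : 0 <= qnorm G v. Proof. exact: sqrtr_ge0. Qed.

Lemma bil_cauchy_schwarz G u v : posdef G -> `|bil G u v| <= qnorm G u * qnorm G v.
Proof.
move=> Gp; have GT := Gp.1.
rewrite -ler_sqr ?nnegrE ?mulr_ge0 ?qnorm_ge0// exprMn !qnorm_sqr// real_normK ?num_real//.
have [->|v0] := eqVneq v 0; first by rewrite (bilC u _ GT) !bil0 mulr0 expr0n.
have c0 := Gp.2 v v0.
have := bil_ge0 (u + (- (bil G u v / bil G v v)) *: v) Gp.
rewrite bilDl !bilDr !bilZl !bilZr (bilC v u GT) => H.
have E : bil G u v / bil G v v * bil G v v = bil G u v by rewrite divfK ?gt_eqF.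
have : 0 <= bil G u u - bil G u v / bil G v v * bil G u v by move: H; set k := _ / _ in E *; nra.
rewrite subr_ge0 mulrAC ler_pdivrMr//.
Qed.

Lemma qnorm_triangle G u v : posdef G -> qnorm G (u + v) <= qnorm G u + qnorm G v.
Proof.
move=> Gp; rewrite -ler_sqr ?nnegrE ?addr_ge0 ?qnorm_ge0// qnorm_sqr// sqrrD !qnorm_sqr//.
rewrite bilDl !bilDr (bilC v u Gp.1).
have := ler_norm (bil G u v); have := bil_cauchy_schwarz u v Gp; lra.
Qed.

Lemma posdef_unit G : posdef G -> G \in unitmx.
Proof.
move=> [_ Gp]; rewrite -row_free_unit -kermx_eq0; apply/eqP/row_matrixP => i.
rewrite row0; apply/eqP; apply: contraT => /Gp.
have : row i (kermx G) *m G = 0 by rewrite -row_mul mulmx_ker row0.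
by rewrite /bil => ->; rewrite mul0mx mxE ltxx.
Qed.

Lemma qnorm_lower G : posdef G ->
  exists2 c : R, 0 < c & forall v, `|v| <= c * qnorm G v.
Proof.
(* [w l] represents the [l]-th coordinate functional with respect to [G], so Cauchy-Schwarz bounds
   every coordinate of [v]. *)
move=> Gp; pose w l := delta_mx 0 l *m invmx G : E.
pose c := 1 + \sum_l qnorm G (w l).
have S0 : 0 <= \sum_l qnorm G (w l) by apply: sumr_ge0 => l _; exact: qnorm_ge0.
exists c => [|v]; first by rewrite ltr_pwDl.
apply/mx_norm_le => [|i l]; first by rewrite mulr_ge0 ?qnorm_ge0// addr_ge0.
have -> : v i l = bil G v (w l).
  rewrite (ord1 i) /bil /w trmx_mul trmx_inv Gp.1 mulmxA mulmxK ?posdef_unit//.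
  by rewrite trmx_delta -colE mxE.
rewrite (le_trans (bil_cauchy_schwarz _ _ Gp))// mulrC ler_wpM2r ?qnorm_ge0//.
rewrite /c (bigD1 l) //= addrCA lerDl addr_ge0// sumr_ge0// => k _.
exact: qnorm_ge0.
Qed.

Lemma bil_le G v : bil G v v <= n%:R ^+ 2 * `|G| * `|v| ^+ 2.
Proof.
apply: le_trans (ler_norm _) _; apply: le_trans (entry_le_norm _ _ _) _.
apply: le_trans (mulmx_norm_le _ _) _.
have -> : `|v^T| = `|v|.
  apply/eqP; rewrite eq_le; apply/andP; split; apply/mx_norm_le => // i j.
    by rewrite mxE entry_le_norm.
  by have := entry_le_norm v^T j i; rewrite mxE.
rewrite -mulrA; have := mulmx_norm_le v G => H.
have -> : n%:R ^+ 2 * `|G| * `|v| ^+ 2 = n%:R * (n%:R * `|v| * `|G| * `|v|) by ring.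
by rewrite ler_wpM2l// ler_wpM2r.
Qed.

(* The determinant does not vanish on the segment from the identity to [G]. *)
Lemma posdef_det G : posdef G -> 0 < \det G.
Proof.
move=> Gp.
pose p : {poly R} :=
  \det (\matrix_(i < n, j < n) ((1 - 'X) * (i == j)%:R + 'X * (G i j)%:P)).
have pE t : p.[t] = \det ((1 - t) *: 1%:M + t *: G).
  rewrite -[LHS]/(horner_eval t p) -det_map_mx; congr (\det _).
  apply/matrixP => i j; rewrite !mxE.
  rewrite -[LHS]/(((1 - 'X) * (i == j)%:R + 'X * (G i j)%:P).[t]).
  by rewrite !(hornerD, hornerM, hornerN, hornerX, hornerC, hornerMn).
have p0 : p.[0] = 1 by rewrite pE subr0 scale1r scale0r addr0 det1.
have p1 : p.[1] = \det G by rewrite pE subrr scale1r scale0r add0r.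
rewrite -p1 ltNge; apply/negP => p1le.
have [||t /andP[t0 t1]] := @poly_ivt _ (- p) 0 1.
- exact: ler01.
- by rewrite !hornerN p0 oppr_ge0 p1le andbT oppr_le0.
rewrite rootN /root pE => /eqP det0.
suff /posdef_unit : posdef ((1 - t) *: 1%:M + t *: G) by rewrite unitmxE det0 unitr0.
split=> [|v v0]; first by rewrite linearD !linearZ /= trmx1 Gp.1.
have -> : bil ((1 - t) *: 1%:M + t *: G) v v = (1 - t) * bil 1%:M v v + t * bil G v v.
  by rewrite /bil mulmxDr mulmxDl -!scalemxAr -!scalemxAl !mxE.
have vv : 0 < bil 1%:M v v.
  rewrite lt_neqAle /bil mulmx1 mxE; under eq_bigr do rewrite mxE -expr2.
  rewrite sumr_ge0 ?andbT; last by move=> *; exact: sqr_ge0.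
  apply: contra v0; rewrite eq_sym psumr_eq0; last by move=> *; exact: sqr_ge0.
  by move=> /allP H; apply/eqP/rowP => k; apply/eqP;
    have := H k (mem_index_enum _); rewrite mxE sqrf_eq0.
have := Gp.2 v v0.
case: (eqVneq t 0) t0 => [-> _|tN0 t0] gv; first by rewrite subr0 mul1r mul0r addr0.
by rewrite ltr_wpDl ?mulr_ge0 ?subr_ge0 ?(ltW vv)// mulr_gt0// lt_neqAle eq_sym tN0.
Qed.

Lemma bil_inj G G' : G^T = G -> G'^T = G' ->
  (forall v, bil G v v = bil G' v v) -> G = G'.
Proof.
move=> GT GT' H; apply/matrixP => i j.
have e (K : 'M[R]_n) : K i j = bil K (delta_mx 0 i) (delta_mx 0 j).
  by rewrite /bil -rowE trmx_delta -colE !mxE.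
rewrite !e; set u := delta_mx 0 i; set v := delta_mx 0 j.
have := H (u + v); rewrite !bilDl !bilDr (bilC v u GT) (bilC v u GT').
rewrite (H u) (H v); lra.
Qed.

End PositiveForms.

(** * Charts and Jacobians *)

Section Charts.
Context (R : realType) (n : nat) (M : topologicalType) (A : smooth_atlas R n M).
Notation E := 'rV[R]_n.
Implicit Types (i j k : index A) (z w : M) (y : E).

Definition cod i : set E := coord i @` dom i.

Lemma cod_param i y : cod i y -> dom i (param i y) /\ coord i (param i y) = y.
Proof. by move=> [z iz <-]; rewrite coordK. Qed.

Lemma cod_coord i z : dom i z -> cod i (coord i z).
Proof. by move=> iz; exists z. Qed.

Lemma near_dom i z : dom i z -> \forall w \near z, dom i w.
Proof. by move=> iz; apply: open_nbhs_nbhs; split=> //; exact: dom_open. Qed.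

Lemma near_cod i y : cod i y -> \forall y' \near y, cod i y'.
Proof. by move=> iy; apply: open_nbhs_nbhs; split=> //; exact: cod_open. Qed.

Lemma near_coord i z (P : E -> Prop) : dom i z ->
  (\forall y \near coord i z, P y) -> \forall w \near z, P (coord i w).
Proof. by move=> iz Py; exact: (coord_continuous iz Py). Qed.

Lemma near_param i z (P : M -> Prop) : dom i z ->
  (\forall w \near z, P w) -> \forall y \near coord i z, P (param i y).
Proof.
move=> iz Pw.
have c : param i @ coord i z --> param i (coord i z).
  exact: param_continuous (cod_coord iz).
by rewrite coordK// in c; exact: c.
Qed.

Lemma overlap_open i j : open (coord i @` (dom i `&` dom j)).
Proof.
rewrite openE => _ [z [iz jz] <-].
rewrite /interior; have H1 := near_param iz (near_dom jz).
apply: filterS2 (near_cod (cod_coord iz)) H1 => y iy jy.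
by have [iy' <-] := cod_param iy; exists (param i y).
Qed.

Lemma transition_jacobian i j z : dom i z -> dom j z ->
  has_jacobian (coord j \o param i) (coord i z) ('J (coord j \o param i) (coord i z)).
Proof.
move=> iz jz; apply/has_jacobianP; split=> //.
apply: (smooth_map_differentiable (@overlap_open i j)); first by exists z.
exact: transition_smooth.
Qed.

Definition map_jacobian (f : M -> M) z i j (J : 'M[R]_n) : Prop :=
  has_jacobian (coord j \o f \o param i) (coord i z) J.

Lemma map_jacobian_comp (f h : M -> M) z i j k J J' :
  dom i z -> dom j (f z) -> {for z, continuous f} ->
  map_jacobian f z i j J -> map_jacobian h (f z) j k J' ->
  map_jacobian (h \o f) z i k (J *m J').
Proof.
move=> iz jfz fc fJ hJ; rewrite /map_jacobian.
have E : (coord j \o f \o param i) (coord i z) = coord j (f z) by rewrite /= coordK.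
have := @has_jacobian_comp _ _ _ _ _ (coord k \o h \o param j) _ _ J' fJ.
rewrite E => /(_ hJ); apply: near_has_jacobian.
have : \forall w \near z, dom j (f w) by exact: (fc _ (near_dom jfz)).
by move=> /(near_param iz); apply: filterS => y jfy; rewrite /= coordK.
Qed.

Lemma near_map_jacobian (f h : M -> M) z i j J : dom i z ->
  (\forall w \near z, f w = h w) -> map_jacobian f z i j J -> map_jacobian h z i j J.
Proof.
move=> iz fh; apply: near_has_jacobian.
by have := near_param iz fh; apply: filterS => y /= ->.
Qed.

(** Changing charts on both sides is composing with the identity map, once read from [i'] to [i] and
    once from [j] to [j']. *)
Lemma map_jacobian_charts (f : M -> M) z i j i' j' J :
  dom i z -> dom j (f z) -> dom i' z -> dom j' (f z) -> {for z, continuous f} ->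
  map_jacobian f z i j J ->
  map_jacobian f z i' j' ('J (coord i \o param i') (coord i' z) *m J *m
    'J (coord j' \o param j) (coord j (f z))).
Proof.
move=> iz jz iz' jz' fc fJ.
have T1 : map_jacobian id z i' i ('J (coord i \o param i') (coord i' z)).
  exact: transition_jacobian.
have T2 : map_jacobian id (f z) j j' ('J (coord j' \o param j) (coord j (f z))).
  exact: transition_jacobian.
apply: (@map_jacobian_comp f id z i' j j') => //.
exact: (@map_jacobian_comp id f z i' i j).
Qed.

Definition mdiff (f : M -> M) z : Prop :=
  {for z, continuous f} /\ differentiable (in_charts A f z) (coord (chart_at A z) z).

Lemma mdiffP (f : M -> M) z : mdiff f z ->
  map_jacobian f z (chart_at A z) (chart_at A (f z)) (dmap A f z).
Proof. by move=> [_ df]; apply/has_jacobianP. Qed.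

Lemma map_jacobian_mdiff (f : M -> M) z i j J :
  dom i z -> dom j (f z) -> {for z, continuous f} -> map_jacobian f z i j J ->
  mdiff f z /\ dmap A f z = 'J (coord i \o param (chart_at A z)) (coord (chart_at A z) z)
    *m J *m 'J (coord (chart_at A (f z)) \o param j) (coord j (f z)).
Proof.
move=> iz jz fc fJ.
have H := map_jacobian_charts iz jz (chart_atP A z) (chart_atP A (f z)) fc fJ.
by have /has_jacobianP[df JE] := H; split; [split|].
Qed.

Lemma mdiff_comp (f h : M -> M) z : mdiff f z -> mdiff h (f z) ->
  mdiff (h \o f) z /\ dmap A (h \o f) z = dmap A f z *m dmap A h (f z).
Proof.
move=> df dh; have fJ := mdiffP df; have hJ := mdiffP dh.
have /has_jacobianP[dhf JE] : map_jacobian (h \o f) z (chart_at A z)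
    (chart_at A (h (f z))) (dmap A f z *m dmap A h (f z)).
  exact: map_jacobian_comp (chart_atP A z) (chart_atP A (f z)) df.1 fJ hJ.
split; [split; [|exact: dhf]|exact: JE].
by apply: continuous_comp; [exact: df.1|exact: dh.1].
Qed.

Lemma near_mdiff (f h : M -> M) z : (\forall w \near z, f w = h w) -> mdiff f z ->
  mdiff h z /\ dmap A h z = dmap A f z.
Proof.
move=> fh df; have fhz := nbhs_singleton fh.
have /has_jacobianP[dh JE] : map_jacobian h z (chart_at A z) (chart_at A (h z)) (dmap A f z).
  by rewrite -fhz; apply: near_map_jacobian (chart_atP A z) fh (mdiffP df).
split; [split; [|exact: dh]|exact: JE].
rewrite /prop_for /continuous_at -fhz.
by apply: cvg_trans df.1; apply: near_eq_cvg.
Qed.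

Lemma mdiff_id z : mdiff id z /\ dmap A id z = 1%:M.
Proof.
suff /has_jacobianP[dh JE] : map_jacobian id z (chart_at A z) (chart_at A z) 1%:M.
  by split; [split; [|exact: dh]|exact: JE].
apply: near_has_jacobian (has_jacobian_id _).
by apply: filterS (near_cod (cod_coord (chart_atP A z))) => y /cod_param[].
Qed.

Lemma C1_holder_mdiff (e : R) (O : set M) (f : M -> M) z :
  C1_holder A e O f -> O z -> mdiff f z.
Proof.
by move=> fC /fC[fc [B Bz [dB _]]]; split=> //; apply: dB; exact: nbhs_singleton.
Qed.

End Charts.

Section JacobianNorm.
Context (R : realType) (n : nat).
Notation E := 'rV[R]_n.
Implicit Types (G : 'M[R]_n) (v y : E).

Lemma qnorm_le G v (c : R) : n%:R ^+ 2 * `|G| <= c -> posdef G ->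
  qnorm G v <= (1 + c) * `|v|.
Proof.
move=> cG Gp; have c0 : 0 <= c by apply: le_trans cG; rewrite mulr_ge0// exprn_ge0.
rewrite -ler_sqr ?nnegrE ?mulr_ge0 ?addr_ge0 ?qnorm_ge0// qnorm_sqr//.
apply: le_trans (bil_le _ _) _; rewrite exprMn ler_wpM2r ?exprn_ge0//.
by apply: (le_trans cG); nra.
Qed.

Lemma jacobian_qnorm (f : E -> E) y J G G' (r : R) :
  has_jacobian f y J -> posdef G -> posdef G' -> 0 <= r ->
  (forall v, qnorm G' (v *m J) <= r * qnorm G v) -> forall e : R, 0 < e ->
  \forall z \near y, qnorm G' (f z - f y) <= (r + e) * qnorm G (z - y).
Proof.
move=> fJ Gp Gp' r0 rJ e e0.
have [c c0 cP] := qnorm_lower Gp.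
pose c' := 1 + n%:R ^+ 2 * `|G'|.
have c'0 : 0 < c' by rewrite ltr_pwDl// mulr_ge0// exprn_ge0.
(* The linearization error is measured in the maximum norm; [c] and [c'] are the prices of
   converting from [qnorm G] and to [qnorm G']. *)
have := fJ (e / (c * c')) (divr_gt0 e0 (mulr_gt0 c0 c'0)); apply: filterS => z fz.
rewrite -(subrK ((z - y) *m J) (f z - f y)) (le_trans (qnorm_triangle _ _ Gp'))//.
rewrite addrC mulrDl lerD//.
apply: le_trans (qnorm_le _ (lexx _) Gp') _; rewrite -/c'.
apply: le_trans (ler_wpM2l (ltW c'0) fz) _.
apply: le_trans (_ : c' * (e / (c * c') * (c * qnorm G (z - y))) <= _).
  by rewrite !ler_wpM2l ?(ltW c'0)// divr_ge0 ?(ltW e0)// mulr_ge0 ?ltW.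
rewrite le_eqVlt; apply/orP; left; apply/eqP; field.
by rewrite !gt_eqF.
Qed.

End JacobianNorm.

(** * Volume density, Jacobian determinant and first-order length in charts *)

Section Riemannian.
Context (R : realType) (n : nat) (M : topologicalType) (A : smooth_atlas R n M).
Context (g : riemannian_metric A).
Notation E := 'rV[R]_n.
Implicit Types (i j k : index A) (z w : M) (y : E).

Lemma gram_posdef i y : cod i y -> posdef (gram g i y).
Proof. by move=> iy; split; [exact: gram_sym|exact: gram_pos]. Qed.

Lemma gram_at_posdef z : posdef (gram_at g z).
Proof. by apply: gram_posdef; apply: cod_coord; exact: chart_atP. Qed.

Lemma gram_change i j z : dom i z -> dom j z ->
  let J := 'J (coord j \o param i) (coord i z) in
  gram g i (coord i z) = J *m gram g j (coord j z) *m J^T.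
Proof.
move=> iz jz; have := @gram_transition _ _ _ _ g i j (coord i z).
by rewrite /= coordK//; apply; exists z.
Qed.

(** The density of the Riemannian volume in the chart [i]. *)
Definition vol i y : R := Num.sqrt (\det (gram g i y)).

Lemma vol_gt0 i z : dom i z -> 0 < vol i (coord i z).
Proof. by move=> iz; rewrite sqrtr_gt0 posdef_det//; apply: gram_posdef (cod_coord iz). Qed.

Lemma vol_change i j z : dom i z -> dom j z ->
  vol i (coord i z) = `|\det ('J (coord j \o param i) (coord i z))| * vol j (coord j z).
Proof.
move=> iz jz; rewrite {1}/vol (gram_change iz jz) !det_mulmx det_tr mulrAC -expr2.
by rewrite sqrtrM ?sqr_ge0// sqrtr_sqr.
Qed.

(** [absdet] is defined through the preferred charts of [z] and [f z], which may jump from point to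
    point. Here it is moved to fixed charts, where its dependence on [z] can be studied; the
    determinants of the transition maps cancel against the change of the densities. *)
Lemma absdet_charts (f : M -> M) z i j J :
  dom i z -> dom j (f z) -> {for z, continuous f} -> map_jacobian f z i j J ->
  absdet g f z = `|\det J| * vol j (coord j (f z)) / vol i (coord i z).
Proof.
move=> iz jz fc fJ; have [_ DE] := map_jacobian_mdiff iz jz fc fJ.
rewrite /absdet {}DE !det_mulmx !normrM.
have v1 := vol_change (chart_atP A z) iz; have v2 := vol_change jz (chart_atP A (f z)).
rewrite -/(vol (chart_at A (f z)) (coord (chart_at A (f z)) (f z))).
rewrite -/(vol (chart_at A z) (coord (chart_at A z) z)).
have v0 := vol_gt0 (chart_atP A z); have i0 := vol_gt0 iz.
have alg (a d b vf vz vj vi : R) : vz = a * vi -> vj = b * vf -> 0 < vz ->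
    0 < vi -> a * d * b * vf / vz = d * vj / vi.
  move=> -> -> + i0'; rewrite pmulr_lgt0// => a0.
  by field; rewrite !gt_eqF.
exact: alg v1 v2 v0 i0.
Qed.

Lemma absdet_comp (f h : M -> M) z : mdiff A f z -> mdiff A h (f z) ->
  absdet g (h \o f) z = absdet g h (f z) * absdet g f z.
Proof.
move=> df dh; have [_ DE] := mdiff_comp df dh.
rewrite /absdet DE det_mulmx normrM.
have alg (a b vf vz vh : R) : 0 < vf -> 0 < vz ->
    a * b * vh / vz = b * vh / vf * (a * vf / vz).
  by move=> f0 z0; field; rewrite !gt_eqF.
exact: alg (vol_gt0 (chart_atP A (f z))) (vol_gt0 (chart_atP A z)).
Qed.

Lemma near_absdet (f h : M -> M) z : (\forall w \near z, f w = h w) -> mdiff A f z ->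
  absdet g h z = absdet g f z.
Proof.
move=> fh df; have [_ DE] := near_mdiff fh df.
by rewrite /absdet DE (nbhs_singleton fh).
Qed.

Lemma absdet_id z : absdet g id z = 1.
Proof.
have [_ DE] := mdiff_id A z; rewrite /absdet DE det1 normr1 mul1r /=.
by have v0 := vol_gt0 (chart_atP A z); rewrite divff// gt_eqF.
Qed.

(** By polarization the derivative [D] satisfies [D *m G' *m D^T = r ^+ 2 *: G] for the Gram
    matrices [G] at [z] and [G'] at [f z]; the claim follows on taking determinants. *)
Lemma conformal_absdet (f : M -> M) z (r : R) : 0 < r ->
  (forall v : E, tnorm g (f z) (v *m dmap A f z) = r * tnorm g z v) ->
  absdet g f z = r ^+ n.
Proof.
move=> r0 fr; set D := dmap A f z.
have Gp := gram_at_posdef z; have Gp' := gram_at_posdef (f z).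
have H : D *m gram_at g (f z) *m D^T = r ^+ 2 *: gram_at g z.
  apply: bil_inj => [||v].
  - by rewrite !trmx_mul trmxK Gp'.1 mulmxA.
  - by rewrite linearZ /= Gp.1.
  have -> : bil (D *m gram_at g (f z) *m D^T) v v
      = bil (gram_at g (f z)) (v *m D) (v *m D).
    by rewrite /bil trmx_mul !mulmxA.
  have -> : bil (r ^+ 2 *: gram_at g z) v v = r ^+ 2 * bil (gram_at g z) v v.
    by rewrite /bil -scalemxAr -scalemxAl mxE.
  by rewrite -!qnorm_sqr// -exprMn; congr (_ ^+ 2); exact: fr.
have v0 := vol_gt0 (chart_atP A z).
have := congr1 (Num.sqrt \o determinant) H.
rewrite /= !det_mulmx det_tr detZ -mulrA mulrCA mulrC -expr2.
rewrite (sqrtrM _ (sqr_ge0 _)) (sqrtrM _ (exprn_ge0 _ (sqr_ge0 _))) sqrtr_sqr.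
rewrite -exprM mulnC exprM sqrtr_sqr (ger0_norm (exprn_ge0 n (ltW r0))).
by rewrite /absdet => ->; rewrite mulfK// gt_eqF.
Qed.

(* The first-order length of the displacement from [z] to a nearby point [w]. *)
Definition qdist z w : R := tnorm g z (coord (chart_at A z) w - coord (chart_at A z) z).

Lemma qdist_ge0 z w : 0 <= qdist z w. Proof. exact: qnorm_ge0. Qed.

Lemma near_conformal_qdist (f : M -> M) z (r : R) : mdiff A f z -> 0 < r ->
  (forall v : E, tnorm g (f z) (v *m dmap A f z) = r * tnorm g z v) ->
  forall e : R, 0 < e -> \forall w \near z, qdist (f z) (f w) <= (r + e) * qdist z w.
Proof.
move=> df r0 fr e e0; have iz := chart_atP A z.
have H := jacobian_qnorm (mdiffP df) (gram_at_posdef z) (gram_at_posdef (f z)) (ltW r0).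
have fr' v : tnorm g (f z) (v *m dmap A f z) <= r * tnorm g z v by rewrite fr.
have {}H := H fr' e e0.
apply: filterS2 (near_dom iz) (near_coord iz H) => w iw.
by rewrite /= !coordK.
Qed.

(** A transition map preserves the Gram forms, so to first order a displacement has the same length
    in all charts. *)
Lemma near_qdist_chart i z : dom i z -> forall e : R, 0 < e ->
  \forall w \near z, qdist z w <= (1 + e) * qnorm (gram g i (coord i z)) (coord i w - coord i z)
    /\ qnorm (gram g i (coord i z)) (coord i w - coord i z) <= (1 + e) * qdist z w.
Proof.
move=> iz e e0; have cz := chart_atP A z; pose c := chart_at A z.
have Gi : posdef (gram g i (coord i z)) by apply: gram_posdef; exact: cod_coord.
have H (a b : index A) (az : dom a z) (bz : dom b z) : \forall w \near z,
    qnorm (gram g b (coord b z)) (coord b w - coord b z) <=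
    (1 + e) * qnorm (gram g a (coord a z)) (coord a w - coord a z).
  have K := jacobian_qnorm (transition_jacobian az bz) (gram_posdef (cod_coord az))
     (gram_posdef (cod_coord bz)) ler01.
  have J1 v : qnorm (gram g b (coord b z)) (v *m 'J (coord b \o param a) (coord a z))
      <= 1 * qnorm (gram g a (coord a z)) v.
    by rewrite (gram_change az bz) mul1r /qnorm /bil trmx_mul !mulmxA.
  have {}K := K J1 e e0.
  by apply: filterS2 (near_dom az) (near_coord az K) => w aw; rewrite /= !coordK.
by apply: filterS2 (H i c iz cz) (H c i cz iz) => w; split.
Qed.

Lemma gram_continuous i y : cod i y -> forall e : R, 0 < e ->
  \forall y' \near y, `|gram g i y' - gram g i y| <= e.
Proof.
move=> iy e e0.
have : \forall y' \near y, forall a, forall b, `|gram g i y' a b - gram g i y a b| <= e.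
  apply: (near_forall_ord (nbhs_filter y)) => a.
  apply: (near_forall_ord (nbhs_filter y)) => b.
  have [fc _] := @gram_smooth _ _ _ _ g i a b 0%N.
  by exact: (@cvgr_distC_le _ _ _ _ (nbhs_filter y) _ _ (fc y iy) _ e0).
apply: filterS => y' H; apply/mx_norm_le; first exact: ltW.
by move=> a b; rewrite !mxE.
Qed.

Lemma gram_bounds i y : cod i y -> exists2 C : R, 0 < C &
  \forall y' \near y, forall v, `|v| <= C * qnorm (gram g i y') v /\
     qnorm (gram g i y') v <= C * `|v|.
Proof.
move=> iy; have Gp := gram_posdef iy; have [c c0 cP] := qnorm_lower Gp.
pose N2 : R := n%:R ^+ 2; have N0 : 0 <= N2 by rewrite exprn_ge0.
(* The tolerance is such that changing the Gram matrix by [d] changes the form by at most half of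
   its value at [y]. *)
pose d : R := (2 * c ^+ 2 * (N2 + 1))^-1.
have d0 : 0 < d by rewrite invr_gt0 !mulr_gt0// ?exprn_gt0// ltr_wpDl.
pose C := 2 * c + (1 + N2 * (`|gram g i y| + d)).
have C1 : 0 < 1 + N2 * (`|gram g i y| + d).
  by rewrite ltr_pwDl// mulr_ge0// addr_ge0// ltW.
exists C; first by rewrite addr_gt0// mulr_gt0.
apply: filterS2 (near_cod iy) (gram_continuous iy d0) => y' iy' Hd v.
have Gp' := gram_posdef iy'.
split.
  apply: le_trans (_ : 2 * c * qnorm (gram g i y') v <= _); last first.
    by rewrite ler_wpM2r ?qnorm_ge0// lerDl ltW.
  (* The perturbation estimate gives the factor 2; it is weakened to 4, whose square root is the 2
     in [2 * c]. *)
  have H : bil (gram g i y) v v <= 4 * bil (gram g i y') v v.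
    have := bil_le (gram g i y - gram g i y') v.
    have -> : bil (gram g i y - gram g i y') v v
        = bil (gram g i y) v v - bil (gram g i y') v v.
      by rewrite /bil mulmxBr mulmxBl !mxE.
    rewrite distrC in Hd => H1.
    have H2 : N2 * `|gram g i y - gram g i y'| * `|v| ^+ 2 <=
        N2 * d * (c ^+ 2 * bil (gram g i y) v v).
      apply: ler_pM; rewrite ?mulr_ge0 ?exprn_ge0//; first by rewrite ler_wpM2l.
      by rewrite -qnorm_sqr// -exprMn ler_sqr ?nnegrE ?mulr_ge0 ?qnorm_ge0 ?(ltW c0).
    have H3 : N2 * d * c ^+ 2 <= 1 / 2.
      rewrite /d; have -> : N2 / (2 * c ^+ 2 * (N2 + 1)) * c ^+ 2 = N2 / (N2 + 1) / 2.
        by field; rewrite ?gt_eqF// ltr_wpDl.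
      by rewrite ler_wpM2r// ler_pdivrMr ?mul1r ?lerDl// ltr_wpDl.
    have b0 := bil_ge0 v Gp.
    have H4 : N2 * d * (c ^+ 2 * bil (gram g i y) v v) <= 1 / 2 * bil (gram g i y) v v.
      by rewrite mulrA ler_wpM2r.
    have := bil_ge0 v Gp'; move: H1; rewrite -/N2; lra.
  apply: (le_trans (cP v)); rewrite -mulrA mulrCA ler_wpM2l ?(ltW c0)//.
  rewrite -ler_sqr ?nnegrE ?mulr_ge0 ?qnorm_ge0// exprMn !qnorm_sqr//.
  by rewrite -natrX.
apply: le_trans (qnorm_le v (lexx _) Gp') _; rewrite ler_wpM2r//.
rewrite -/N2 /C; have : N2 * `|gram g i y'| <= N2 * (`|gram g i y| + d).
  rewrite ler_wpM2l// -(subrK (gram g i y) (gram g i y')) (le_trans (ler_normD _ _))//.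
  by rewrite addrC lerD.
by move: c0; lra.
Qed.

End Riemannian.

(** * The dual distance *)

Lemma near_continuous (T T' : topologicalType) (S : T -> T') (z : T) (P : T' -> Prop) :
  {for z, continuous S} -> (\forall w \near S z, P w) -> \forall w \near z, P (S w).
Proof. by move=> Sc Pw; exact: Sc. Qed.

Section DualMetric.
Context (R : realType) (n : nat) (M : topologicalType) (A : smooth_atlas R n M).
Context (g : riemannian_metric A) (M_hausdorff : hausdorff_space M) (U : set M).
Notation E := 'rV[R]_n.
Notation q := (qdist g).
Implicit Types (f h : M -> R) (z w x : M) (c e r : R).

Definition slope_le f z c : Prop := forall e, 0 < e ->
  \forall w \near z, `|f w - f z| <= (c + e) * q z w.

Definition unit_slope f : Prop := forall z, U z -> slope_le f z 1.

(* The supremum of [`|f x - f y|] over the functions of slope at most 1 on [U]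
   plays the role of the inner distance of [U]. *)
Definition dual_le x y (D : R) : Prop := forall f, unit_slope f -> `|f x - f y| <= D.

Definition stretch_le (S : M -> M) z r : Prop := {for z, continuous S} /\
  forall e, 0 < e -> \forall w \near z, q (S z) (S w) <= (r + e) * q z w.

Lemma slope_le_mono f z c c' : c <= c' -> slope_le f z c -> slope_le f z c'.
Proof.
move=> cc' fc e e0; apply: filterS (fc e e0) => w /le_trans; apply.
by rewrite ler_wpM2r ?qdist_ge0// lerD2r.
Qed.

Lemma slope_leD f h z c c' : slope_le f z c -> slope_le h z c' ->
  slope_le (fun w => f w + h w) z (c + c').
Proof.
move=> fc hc e e0; have e2 : 0 < e / 2 by rewrite divr_gt0.
apply: filterS2 (fc _ e2) (hc _ e2) => w Hf Hh.
have -> : f w + h w - (f z + h z) = (f w - f z) + (h w - h z) by lra.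
by apply: le_trans (ler_normD _ _) _; move: Hf Hh; set k := q z w; lra.
Qed.

Lemma slope_leZ f z c (k : R) : 0 < k -> slope_le f z c ->
  slope_le (fun w => k * f w) z (k * c).
Proof.
move=> k0 fc e e0; apply: filterS (fc _ (divr_gt0 e0 k0)) => w Hf.
rewrite -mulrBr normrM gtr0_norm//.
have -> : k * c + e = k * (c + e / k) by field; rewrite gt_eqF.
by rewrite -mulrA ler_wpM2l// ltW.
Qed.

Lemma slope_leN f z c : slope_le f z c -> slope_le (fun w => - f w) z c.
Proof.
move=> fc e e0; apply: filterS (fc _ e0) => w.
by rewrite -opprD normrN.
Qed.

Lemma slope_le_const f z : (\forall w \near z, f w = f z) -> slope_le f z 0.
Proof.
move=> fc e e0; apply: filterS fc => w ->; rewrite subrr normr0.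
by rewrite mulr_ge0 ?qdist_ge0// add0r ltW.
Qed.

Lemma slope_le_comp f (S : M -> M) z c r : 0 <= c -> 0 <= r ->
  slope_le f (S z) c -> stretch_le S z r -> slope_le (f \o S) z (c * r).
Proof.
move=> c0 r0 fc [Sc Sr] e e0.
(* Since [d <= 1], the product [(c + d) * (r + d)] exceeds [c * r] by at most [d * (c + r + 1)],
   hence by at most [e]. *)
pose d := Num.min 1 (e / (c + r + 1)).
have cr : 0 < c + r + 1 by lra.
have d0 : 0 < d by rewrite lt_min ltr01 divr_gt0.
apply: filterS2 (near_continuous Sc (fc _ d0)) (Sr _ d0) => w /= H1 H2.
apply: (le_trans H1); apply: le_trans (ler_wpM2l _ H2) _; first by rewrite addr_ge0 ?(ltW d0).
rewrite mulrA ler_wpM2r ?qdist_ge0//.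
have d1 : d <= 1 by rewrite ge_min lexx.
have de : d * (c + r + 1) <= e by rewrite -ler_pdivlMr// ge_min lexx orbT.
nra.
Qed.

Lemma dual_le_sym x y D : dual_le x y D -> dual_le y x D.
Proof. by move=> H f /H; rewrite distrC. Qed.

Lemma dual_le_trans x y z D D' : dual_le x y D -> dual_le y z D' -> dual_le x z (D + D').
Proof.
by move=> H H' f uf; apply: le_trans (ler_distD (f y) _ _) _; rewrite lerD ?H ?H'.
Qed.

Lemma dual_le_mono x y D D' : D <= D' -> dual_le x y D -> dual_le x y D'.
Proof. by move=> DD' H f uf; apply: le_trans (H f uf) DD'. Qed.

Lemma dual_le_refl x : dual_le x x 0.
Proof. by move=> f _; rewrite subrr normr0. Qed.

(* Radius [4 s] rather than [s]: a [bump] centred in the ball of radius [s] is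
   constant before it leaves the ball of radius [3 s]. *)
Record good_ball (i : index A) (y0 : E) (V : set M) (s C : R) : Prop := {
  good_radius : 0 < s;
  good_const : 0 < C;
  good_cod : forall y, ball y0 (4 * s) y -> cod i y;
  good_in : forall y, ball y0 (4 * s) y -> V (param i y);
  good_lower : forall y, ball y0 (4 * s) y ->
    forall v, `|v| <= C * qnorm (gram g i y) v;
  good_upper : forall y, ball y0 (4 * s) y ->
    forall v, qnorm (gram g i y) v <= C * `|v| }.

Lemma good_ball_exists i x (V : set M) : dom i x -> nbhs x V ->
  exists s C, good_ball i (coord i x) V s C.
Proof.
move=> ix Vx; have [C C0 CP] := gram_bounds g (cod_coord ix).
have H := filterI (near_cod (cod_coord ix)) (filterI (near_param ix Vx) CP).
have /nbhs_ballP[s /= s0 sP] := H (nbhs_filter _) (nbhs_filter _).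
have s4 : 4 * (s / 4) = s by lra.
exists (s / 4), C; split; rewrite ?s4 ?divr_gt0// => y /sP[iy [Vy H']] //.
- by move=> v; have [] := H' v.
- by move=> v; have [] := H' v.
Qed.

Lemma good_ballW i y0 V s s' C : 0 < s' -> s' <= s ->
  good_ball i y0 V s C -> good_ball i y0 V s' C.
Proof.
move=> s'0 ss' [s0 C0 H1 H2 H3 H4].
by split=> // y /(@le_ball _ _ _ _ (4 * s) _) b;
  [apply: H1|apply: H2|apply: H3|apply: H4]; apply: b; lra.
Qed.

(** * Bump functions in a chart ball *)

Section GoodBall.
Context (i : index A) (y0 : E) (V : set M) (s C : R) (GB : good_ball i y0 V s C).

(** In coordinates slope 1 becomes slope at most [C] at each point, and [slope_segment] integrates
    this along the segment from [a] to [b], which stays in the ball. *)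
Lemma good_lipschitz f : (forall z, V z -> slope_le f z 1) ->
  forall a b, ball y0 (4 * s) a -> ball y0 (4 * s) b ->
  `|f (param i b) - f (param i a)| <= C * `|b - a|.
Proof.
move=> fV a b ya yb.
have C0 := good_const GB; have s0 := good_radius GB.
have slopeE y (e : R) : ball y0 (4 * s) y -> 0 < e -> \forall y' \near y,
    `|f (param i y') - f (param i y)| <= (C + e) * `|y' - y|.
  move=> yy e0; have [iy cy] := cod_param (good_cod GB yy).
  (* For [d <= 1] one has [(1 + d) ^+ 2 <= 1 + 3 * d], whence the 3. *)
  pose d := Num.min 1 (e / (3 * C)).
  have d0 : 0 < d by rewrite lt_min ltr01 divr_gt0// mulr_gt0.
  have H : \forall w \near param i y, `|f w - f (param i y)| <= (C + e) * `|coord i w - y|.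
    apply: filterS2 (fV _ (good_in GB yy) _ d0) (near_qdist_chart g iy d0) => w H1 [H2 _].
    rewrite cy in H2; apply: (le_trans H1).
    have H3 := good_upper GB yy (coord i w - y).
    have d1 : d <= 1 by rewrite ge_min lexx.
    have de : d * (3 * C) <= e by rewrite -ler_pdivlMr ?mulr_gt0// ge_min lexx orbT.
    apply: le_trans (_ : (1 + d) * ((1 + d) * (C * `|coord i w - y|)) <= _).
      rewrite ler_wpM2l//; first by rewrite addr_ge0// ltW.
      by apply: (le_trans H2); rewrite ler_wpM2l// addr_ge0// ltW.
    by rewrite !mulrA ler_wpM2r//; nra.
  have := near_param iy H; rewrite cy; apply: filterS2 (near_cod (good_cod GB yy)) => y' iy'.
  by have [_ ->] := cod_param iy'.
pose L (t : R) : E := a + t *: (b - a).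
have L0 : L 0 = a by rewrite /L scale0r addr0.
have L1 : L 1 = b by rewrite /L scale1r addrC subrK.
have LB (t : R) : 0 <= t <= 1 -> ball y0 (4 * s) (L t).
  move=> t01; apply/ball_rowP => [|l]; first by rewrite mulr_gt0.
  rewrite !mxE; have s4 : 0 < 4 * s by rewrite mulr_gt0.
  by apply: convex_dist_lt => //; [exact: (ball_rowP _ _ s4).1|exact: (ball_rowP _ _ s4).1].
have Lc : continuous L.
  by move=> t; apply: cvgD; [exact: cvg_cst|apply: cvgZr_tmp; exact: cvg_id].
rewrite -{1}L0 -{1}L1; apply: (@slope_segment _ (fun t => f (param i (L t)))) => t t01 e e0.
have k0 : 0 < `|b - a| + 1 by rewrite ltr_wpDl.
have H := slopeE _ _ (LB t t01) (divr_gt0 e0 k0).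
apply: filterS (near_continuous (Lc t) H) => t' /= /le_trans; apply.
have -> : L t' - L t = (t' - t) *: (b - a).
  by rewrite /L opprD addrACA subrr add0r scalerBl.
rewrite normrZ mulrA mulrAC ler_wpM2r// mulrDl lerD2l mulrAC ler_pdivrMr//.
by rewrite ler_wpM2l ?(ltW e0)// lerDl.
Qed.

(** The coordinate distance to [x], capped at [s]. The test of [dom i w] discards the junk values of
    [coord i], and outside the ball the cap continues the function to all of [M]. *)
Definition bump x w : R :=
  if `[< dom i w /\ ball y0 (3 * s) (coord i w) >]
  then Num.min `|coord i w - coord i x| s else s.

Lemma bump_near x w : dom i w -> ball y0 (3 * s) (coord i w) ->
  bump x w = Num.min `|coord i w - coord i x| s.
Proof. by move=> iw yw; rewrite /bump; case: asboolP => // -[]. Qed.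

Lemma bump_slope_in x z : dom i z -> ball y0 (3 * s) (coord i z) -> slope_le (bump x) z C.
Proof.
move=> iz yz e e0; have C0 := good_const GB; have s0 := good_radius GB.
have yz4 : ball y0 (4 * s) (coord i z) by apply: le_ball yz; lra.
have H1 : \forall w \near z, ball y0 (3 * s) (coord i w).
  apply: near_coord => //; apply: open_nbhs_nbhs; split=> //.
  exact: ball_open.
apply: filterS3 (near_dom iz) H1 (near_qdist_chart g iz (divr_gt0 e0 C0)) => w iw yw [_ H].
rewrite !bump_near//.
apply: le_trans (_ : `|coord i w - coord i z| <= _).
  have := ler_distD (coord i z) (coord i w) (coord i x).
  have := ler_distD (coord i w) (coord i z) (coord i x).
  rewrite (distrC (coord i z) (coord i w)) ler_norml.
  have := normr_ge0 (coord i w - coord i z).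
  case: (leP `|coord i w - coord i x| s); case: (leP `|coord i z - coord i x| s) => *;
    apply/andP; split; lra.
apply: le_trans (good_lower GB yz4 _) _.
apply: le_trans (ler_wpM2l (ltW C0) H) _.
have -> : C * ((1 + e / C) * q z w) = (C + e) * q z w by field; rewrite gt_eqF.
by [].
Qed.

(* Since [M] is Hausdorff, the image of the closed ball of radius [2 s] is closed
   in [M], and [bump x] is constant off it. *)
Lemma bump_slope_out x z : ball y0 s (coord i x) ->
  ~ (dom i z /\ ball y0 (3 * s) (coord i z)) -> slope_le (bump x) z 0.
Proof.
move=> yx zN; have s0 := good_radius GB.
pose K0 : set E := [set y | `|y0 - y| <= 2 * s].
have bE r y : ball y0 r y = (`|y0 - y| < r) :> Prop by rewrite mx_norm_ball.
have K0in y : K0 y -> cod i y.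
  by move=> /= Ky; apply: (good_cod GB); rewrite bE; apply: (le_lt_trans Ky); lra.
have K0c : compact K0.
  apply: bounded_closed_compact.
    exists (`|y0| + 2 * s); split; first exact: num_real.
    move=> r rs y /= Ky; apply/ltW; apply: le_lt_trans rs.
    rewrite -(subrK y0 y) (le_trans (ler_normD _ _))// addrC lerD2l.
    by rewrite distrC.
  have -> : K0 = closed_ball y0 (2 * s) by rewrite closed_ballE// mulr_gt0.
  exact: closed_ball_closed.
have Kc : compact (param i @` K0).
  apply: continuous_compact K0c; apply: continuous_in_subspaceT => y.
  by rewrite inE => /K0in /param_continuous.
have Kcl : closed (param i @` K0) := compact_closed M_hausdorff Kc.
have zK : ~ (param i @` K0) z.
  move=> [y Ky yz]; apply: zN; rewrite -yz; have [iy ->] := cod_param (K0in y Ky).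
  by split=> //; rewrite bE; apply: (le_lt_trans Ky); lra.
have bz : bump x z = s by rewrite /bump; case: asboolP.
apply: slope_le_const; rewrite bz.
have : \forall w \near z, ~ (param i @` K0) w.
  by apply: open_nbhs_nbhs; split=> //; exact: closed_openC.
apply: filterS => w wK; rewrite /bump; case: asboolP => // -[iw yw].
apply/min_idPr; rewrite leNgt; apply/negP => wx; apply: wK.
exists (coord i w); last by rewrite coordK.
rewrite /K0 /=; apply: le_trans (ler_distD (coord i x) _ _) _.
rewrite distrC in wx; move: yx; rewrite bE => yx; lra.
Qed.

Lemma bump_ge0 x w : 0 <= bump x w.
Proof.
have s0 := ltW (good_radius GB).
by rewrite /bump; case: asboolP => // _; rewrite le_min normr_ge0.
Qed.

Lemma bump_self x : dom i x -> ball y0 s (coord i x) -> bump x x = 0.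
Proof.
move=> ix yx; have s0 := good_radius GB.
rewrite bump_near//; last by apply: le_ball yx; lra.
by rewrite subrr normr0; apply/min_idPl; rewrite ltW.
Qed.

(** Divided by [C], the bump has slope at most 1 everywhere and is thus admissible in the dual
    distance. *)
Lemma dual_le_bump x y D : dom i x -> ball y0 s (coord i x) ->
  dual_le x y D -> bump x y <= C * D.
Proof.
move=> ix yx H; have C0 := good_const GB.
have ub : unit_slope (fun w => C^-1 * bump x w).
  move=> z _; rewrite -(mulVf (lt0r_neq0 C0)).
  apply: slope_leZ; first by rewrite invr_gt0.
  have [[iz yz]|zN] := pselect (dom i z /\ ball y0 (3 * s) (coord i z)).
    exact: bump_slope_in.
  by apply: slope_le_mono (bump_slope_out yx zN); exact: ltW.
have := H _ ub; rewrite bump_self// mulr0 sub0r normrN.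
by rewrite ger0_norm ?mulr_ge0 ?invr_ge0 ?bump_ge0 ?(ltW C0)// ler_pdivrMl.
Qed.

(** Within coordinate distance [s] the Lipschitz bound in the chart applies. In all other cases
    [bump x y = s], so the global bound [DW] equals [DW / s] times the bump. *)
Lemma bump_dual_le x y DW : V `<=` U -> dom i x -> ball y0 s (coord i x) ->
  dual_le x y DW -> dual_le x y ((C + DW / s) * bump x y).
Proof.
move=> VU ix yx H f uf; have C0 := good_const GB; have s0 := good_radius GB.
have DW0 : 0 <= DW by apply: le_trans (H f uf).
have fV z : V z -> slope_le f z 1 by move=> /VU; exact: uf.
rewrite /bump; case: asboolP => [[iy yy]|_]; last first.
  apply: le_trans (H f uf) _; rewrite mulrDl divfK ?gt_eqF//.
  by rewrite lerDr mulr_ge0// ltW.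
have [lts|les] := leP `|coord i y - coord i x| s.
  have := @good_lipschitz f fV (coord i y) (coord i x).
  rewrite !coordK// distrC (distrC (coord i x)) distrC => /(_ _ _)/le_trans; apply.
  - by apply: le_ball yy; lra.
  - by apply: le_ball yx; lra.
  by rewrite ler_wpM2r// lerDl divr_ge0// ltW.
apply: le_trans (H f uf) _; rewrite mulrDl divfK ?gt_eqF//.
by rewrite lerDr mulr_ge0// ltW.
Qed.

(* [f \o S + (1 - r) / C * bump x] still has slope at most 1, because [S] contracts
   by [r] wherever [bump x] is not locally constant. *)
Lemma bump_contraction (S : M -> M) (rho : M -> R) r x y D f : V `<=` U ->
  dom i x -> ball y0 s (coord i x) ->
  (forall z, U z -> [/\ U (S z), stretch_le S z (rho z) & 0 <= rho z <= 1]) ->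
  (forall z, V z -> rho z <= r) -> r < 1 ->
  dual_le x y D -> unit_slope f ->
  `|f (S x) - f (S y)| + (1 - r) / C * bump x y <= D.
Proof.
move=> VU ix yx SU rV r1 H uf; have C0 := good_const GB; have s0 := good_radius GB.
have k0 : 0 < (1 - r) / C by rewrite divr_gt0// subr_gt0.
have key h : unit_slope h -> h (S y) - h (S x) + (1 - r) / C * bump x y <= D.
  move=> uh; have := H (fun w => h (S w) + (1 - r) / C * bump x w) _.
  rewrite distrC bump_self// mulr0 addr0 => /(_ _)/(le_trans (ler_norm _)).
  rewrite addrAC; apply=> z Uz.
  have [USz Sr /andP[r0 rz1]] := SU z Uz.
  have [[iz yz]|zN] := pselect (dom i z /\ ball y0 (3 * s) (coord i z)).
    have Vz : V z.
      rewrite -(coordK iz); apply: (good_in GB); apply: le_ball yz; lra.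
    apply: slope_le_mono (slope_leD (slope_le_comp ler01 r0 (uh _ USz) Sr)
       (slope_leZ k0 (bump_slope_in x iz yz))).
    by rewrite mul1r divfK ?gt_eqF//; have := rV z Vz; lra.
  apply: slope_le_mono (slope_leD (slope_le_comp ler01 r0 (uh _ USz) Sr)
       (slope_leZ k0 (bump_slope_out yx zN))).
  by rewrite mul1r mulr0 addr0.
have := key f uf; have := key (fun w => - f w) (fun z Uz => slope_leN (uf z Uz)).
set b := (1 - r) / C * bump x y => H1 H2.
by rewrite -lerBrDr ler_norml; apply/andP; split; lra.
Qed.

End GoodBall.

Lemma unit_slope_cst (c : R) : unit_slope (fun=> c).
Proof.
move=> z _; apply: slope_le_mono ler01 _; apply: slope_le_const.
by near=> w. Unshelve. all: by end_near.
Qed.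

Lemma dual_le_ge0 x y D : dual_le x y D -> 0 <= D.
Proof. by move=> /(_ _ (unit_slope_cst 0)); rewrite subrr normr0. Qed.

Lemma dual_le_contraction i y0 V s C (S : M -> M) (rho : M -> R) r x y D DW :
  good_ball i y0 V s C -> V `<=` U -> dom i x -> ball y0 s (coord i x) ->
  (forall z, U z -> [/\ U (S z), stretch_le S z (rho z) & 0 <= rho z <= 1]) ->
  (forall z, V z -> rho z <= r) -> 0 <= r < 1 ->
  dual_le x y DW -> dual_le x y D ->
  dual_le (S x) (S y) ((1 - (1 - r) / (C * (C + DW / s + C^-1))) * D).
Proof.
move=> GB VU ix yx SU rV /andP[r0 r1] HW H f uf.
have C0 := good_const GB; have s0 := good_radius GB.
have DW0 := dual_le_ge0 HW; have b0 := bump_ge0 GB x y.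
(* The summand [C^-1] makes [C * K] at least 1 and so keeps the contraction factor nonnegative. *)
set K := C + DW / s + C^-1; set b := bump _ _ _ _ _ in b0.
have Ci : 0 < C^-1 by rewrite invr_gt0.
have DWs : 0 <= DW / s by rewrite divr_ge0// ltW.
have K0 : 0 < K by rewrite /K; lra.
have CK : 1 <= C * K.
  rewrite /K mulrDr mulfV ?gt_eqF// lerDr mulr_ge0 ?(ltW C0)//.
  by rewrite addr_ge0 ?(ltW C0).
(* [D] may exceed the dual distance by far. As [D'] is also at most [K * b], a gain proportional to
   [b] becomes a gain proportional to [D']. *)
pose D' := Num.min D (K * b).
have HD' : dual_le x y D'.
  move=> h uh; rewrite le_min (H h uh) /=.
  apply: le_trans (bump_dual_le GB VU ix yx HW uh) _.
  by rewrite ler_wpM2r// /K; lra.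
have := bump_contraction GB VU ix yx SU rV r1 HD' uf; rewrite -/b => HH.
have D'b : D' / K <= b by rewrite ler_pdivrMr// mulrC ge_min lexx orbT.
have D'D : D' <= D by rewrite ge_min lexx.
have th : 0 <= 1 - (1 - r) / (C * K).
  by rewrite subr_ge0 ler_pdivrMr ?mulr_gt0// mul1r; lra.
apply: le_trans (ler_wpM2l th D'D).
have -> : (1 - (1 - r) / (C * K)) * D' = D' - (1 - r) / C * (D' / K).
  by field; rewrite !gt_eqF.
have : (1 - r) / C * (D' / K) <= (1 - r) / C * b.
  by rewrite ler_wpM2l// divr_ge0 ?(ltW C0)// subr_ge0 ltW.
by move: HH; lra.
Qed.

End DualMetric.

(** * Hoelder continuity of the Jacobian *)

Lemma entry_dist_le (R : realType) m n (A B : 'M[R]_(m, n)) i j :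
  `|A i j - B i j| <= `|A - B|.
Proof. by have := entry_le_norm (A - B) i j; rewrite !mxE. Qed.

Section Hoelder.
Context (R : realType) (n : nat) (e : R) (e0 : 0 < e) (e1 : e <= 1).
Notation E := 'rV[R]_n.
Implicit Types (h : E -> R) (y : E).

Definition hoelder_at h y : Prop := exists2 B : set E, nbhs y B &
  exists C : R, forall a b, B a -> B b -> `|h a - h b| <= C * `|a - b| `^ e.

Lemma eq_hoelder_at h h' y : (forall a, h a = h' a) -> hoelder_at h y -> hoelder_at h' y.
Proof. by move=> /funext ->. Qed.

Lemma hoelder_lipschitz h y (B : set E) (C : R) : nbhs y B ->
  (forall a b, B a -> B b -> `|h a - h b| <= C * `|a - b|) -> hoelder_at h y.
Proof.
(* Points in a ball of radius one half have distance less than 1, where [t] is at most its power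
   with exponent [e <= 1]. *)
move=> By hC; exists (B `&` ball y (2^-1)).
  by apply: filterI => //; apply: nbhsx_ballx; rewrite invr_gt0.
exists `|C| => a b [Ba ya] [Bb yb]; apply: le_trans (hC a b Ba Bb) _.
apply: le_trans (ler_wpM2r (normr_ge0 _) (ler_norm C)) _; rewrite ler_wpM2l//.
have [->|ab] := eqVneq a b; first by rewrite subrr normr0 powR_ge0.
apply: ger1_powR => //; rewrite normr_gt0 subr_eq0 ab /=.
move: ya yb; rewrite !mx_norm_ball /ball_ /= => ya yb.
by have := ler_distD y a b; rewrite distrC in ya; lra.
Qed.

Lemma hoelder_cst (c : R) y : hoelder_at (fun=> c) y.
Proof.
apply: (@hoelder_lipschitz _ _ setT 0) => [|a b _ _]; first exact: filterT.
by rewrite subrr normr0 mul0r.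
Qed.

Lemma hoelderD h h' y : hoelder_at h y -> hoelder_at h' y ->
  hoelder_at (fun a => h a + h' a) y.
Proof.
move=> [B By [C hC]] [B' By' [C' hC']]; exists (B `&` B'); first exact: filterI.
exists (C + C') => a b [Ba Ba'] [Bb Bb'].
have -> : h a + h' a - (h b + h' b) = (h a - h b) + (h' a - h' b) by lra.
by apply: le_trans (ler_normD _ _) _; rewrite mulrDl lerD ?hC ?hC'.
Qed.

Lemma hoelder_bounded h y : hoelder_at h y ->
  exists2 K : R, 0 <= K & \forall a \near y, `|h a| <= K.
Proof.
move=> [B By [C hC]]; have yB := nbhs_singleton By.
exists (`|h y| + `|C|); first by rewrite addr_ge0.
have : nbhs y (B `&` ball y 1) by apply: filterI => //; exact: nbhsx_ballx.
apply: filterS => a [Ba]; rewrite mx_norm_ball /ball_ /= distrC => ya.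
rewrite -(subrK (h y) (h a)) (le_trans (ler_normD _ _))// addrC lerD2l.
apply: le_trans (hC a y Ba yB) _; apply: le_trans (ler_wpM2r _ (ler_norm C)) _.
  exact: powR_ge0.
rewrite ler_piMr//; have <- : 1 `^ e = 1 :> R by rewrite powR1.
by apply: ge0_ler_powR; rewrite ?nnegrE//; exact: ltW.
Qed.

Lemma hoelder_continuous h y (d : R) : hoelder_at h y -> 0 < d ->
  \forall a \near y, `|h a - h y| <= d.
Proof.
move=> [B By [C hC]] d0; have yB := nbhs_singleton By.
have C0 : 0 < `|C| + 1 by rewrite ltr_wpDl.
have t0 : 0 < (d / (`|C| + 1)) `^ e^-1 by apply: powR_gt0; rewrite divr_gt0.
have : nbhs y (B `&` ball y ((d / (`|C| + 1)) `^ e^-1)).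
  by apply: filterI => //; exact: nbhsx_ballx.
apply: filterS => a [Ba]; rewrite mx_norm_ball /ball_ /= distrC => ya.
apply: le_trans (hC a y Ba yB) _; apply: le_trans (ler_wpM2r _ (ler_norm C)) _.
  exact: powR_ge0.
have : `|a - y| `^ e <= d / (`|C| + 1).
  have -> : d / (`|C| + 1) = ((d / (`|C| + 1)) `^ e^-1) `^ e.
    by rewrite -powRrM mulVf ?gt_eqF// powRr1// divr_ge0// ltW.
  apply: ge0_ler_powR; rewrite ?nnegrE//; exact: ltW.
rewrite ler_pdivlMr// => H; apply: le_trans H; rewrite mulrC ler_wpM2l ?powR_ge0//.
by rewrite lerDl.
Qed.

Lemma hoelderM h h' y : hoelder_at h y -> hoelder_at h' y ->
  hoelder_at (fun a => h a * h' a) y.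
Proof.
move=> hh hh'; have [K K0 hK] := hoelder_bounded hh.
have [K' K'0 hK'] := hoelder_bounded hh'.
move: hh hh' => [B By [C hC]] [B' By' [C' hC']].
exists ((B `&` B') `&` ([set a | `|h a| <= K] `&` [set a | `|h' a| <= K'])).
  by apply: filterI; apply: filterI.
exists (K * C' + K' * C) => a b [[Ba Ba'] [/= Ka Ka']] [[Bb Bb'] [/= Kb Kb']].
have -> : h a * h' a - h b * h' b = h a * (h' a - h' b) + h' b * (h a - h b) by ring.
apply: le_trans (ler_normD _ _) _; rewrite mulrDl !normrM -!mulrA.
by apply: lerD; apply: ler_pM => //; [exact: hC'|exact: hC].
Qed.

Lemma hoelderN h y : hoelder_at h y -> hoelder_at (fun a => - h a) y.
Proof.
move=> hh; apply: eq_hoelder_at (hoelderM (hoelder_cst (-1) y) hh) => a.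
by rewrite mulN1r.
Qed.

Lemma hoelder_sum I (r : seq I) (P : pred I) (h : I -> E -> R) y :
  (forall i, hoelder_at (h i) y) -> hoelder_at (fun a => \sum_(i <- r | P i) h i a) y.
Proof.
move=> hh; elim: r => [|i r IH].
  by apply: eq_hoelder_at (hoelder_cst 0 y) => a; rewrite big_nil.
case Pi : (P i); last by apply: eq_hoelder_at IH => a; rewrite big_cons Pi.
by apply: eq_hoelder_at (hoelderD (hh i) IH) => a; rewrite big_cons Pi.
Qed.

Lemma hoelder_prod I (r : seq I) (P : pred I) (h : I -> E -> R) y :
  (forall i, hoelder_at (h i) y) -> hoelder_at (fun a => \prod_(i <- r | P i) h i a) y.
Proof.
move=> hh; elim: r => [|i r IH].
  by apply: eq_hoelder_at (hoelder_cst 1 y) => a; rewrite big_nil.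
case Pi : (P i); last by apply: eq_hoelder_at IH => a; rewrite big_cons Pi.
by apply: eq_hoelder_at (hoelderM (hh i) IH) => a; rewrite big_cons Pi.
Qed.

Lemma hoelder_det m (F : E -> 'M[R]_m) y :
  (forall i j, hoelder_at (fun a => F a i j) y) -> hoelder_at (fun a => \det (F a)) y.
Proof.
move=> hF; apply: hoelder_sum => s.
by apply: hoelderM; [exact: hoelder_cst|exact: hoelder_prod].
Qed.

Lemma ln_lipschitz (m u v : R) : 0 < m -> m <= u -> m <= v ->
  `|ln u - ln v| <= m^-1 * `|u - v|.
Proof.
move=> m0; wlog uv : u v / v <= u.
  move=> H mu mv; case: (leP v u) => [|/ltW] uv; first exact: H.
  by rewrite distrC (distrC u); apply: H.
move=> mu mv; have v0 := lt_le_trans m0 mv; have u0 := lt_le_trans m0 mu.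
rewrite !ger0_norm ?subr_ge0 ?ler_ln ?posrE//.
rewrite -ln_div ?posrE//; have -> : u / v = 1 + (u - v) / v by field; rewrite gt_eqF.
apply: (@le_trans _ _ ((u - v) / v)).
  apply: le_ln1Dx; apply: lt_le_trans (_ : 0 <= _); rewrite ?ltrN10//.
  by rewrite divr_ge0 ?subr_ge0 ?(ltW v0).
by rewrite mulrC ler_wpM2r ?subr_ge0// lef_pV2 ?posrE.
Qed.

Lemma hoelder_ln h y : 0 < h y -> hoelder_at h y -> hoelder_at (fun a => ln (h a)) y.
Proof.
move=> hy hh; have m0 : 0 < h y / 2 by rewrite divr_gt0.
have H := hoelder_continuous hh m0; move: hh => [B By [C hC]].
exists (B `&` [set a | `|h a - h y| <= h y / 2]); first exact: filterI.
exists ((h y / 2)^-1 * C) => a b [Ba /= Ha] [Bb /= Hb].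
apply: le_trans (ln_lipschitz m0 _ _) _.
- by move: Ha; rewrite ler_norml => /andP[]; lra.
- by move: Hb; rewrite ler_norml => /andP[]; lra.
by rewrite -mulrA ler_wpM2l ?invr_ge0 ?(ltW m0)//; exact: hC.
Qed.

End Hoelder.

(** * The logarithm of the Jacobian determinant in charts *)

Section HoelderAbsdet.
Context (R : realType) (n : nat) (M : topologicalType) (A : smooth_atlas R n M).
Context (g : riemannian_metric A) (e : R) (e0 : 0 < e) (e1 : e <= 1).
Notation E := 'rV[R]_n.

Lemma gram_lipschitz (i : index A) (y : E) (a b : 'I_n) : cod i y ->
  exists2 B : set E, nbhs y B & exists C : R, forall z w, B z -> B w ->
    `|gram g i z a b - gram g i w a b| <= C * `|z - w|.
Proof.
move=> iy; have [s s0 [C sC]] := Ck1_lipschitz (@cod_open _ _ _ A i) iy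
   (@gram_smooth _ _ _ _ g i a b 1%N).
by exists (ball y s); [exact: nbhsx_ballx|exists C => z w zB wB; exact: sC].
Qed.

(** The Jacobian is bounded near [y], and the Taylor estimate with reference derivatives 0 turns the
    bound into a Lipschitz constant. This allows the Gram matrix to be composed with a map that is
    only [C1_holder]. *)
Lemma jacobian_lipschitz (F : E -> E) (y : E) (B : set E) : nbhs y B ->
  (forall z, B z -> differentiable F z) ->
  (forall k l, hoelder_at e (fun z => 'J F z k l) y) ->
  exists2 B' : set E, nbhs y B' & exists C : R, forall z w, B' z -> B' w ->
    `|F z - F w| <= C * `|z - w|.
Proof.
move=> By dF hJ.
have [K KP] : exists K : R, \forall z \near y, forall k, forall l, `|'J F z k l| <= K.
  have H k l : exists K : R, \forall z \near y, `|'J F z k l| <= K.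
    by have [K _ HK] := hoelder_bounded e0 (hJ k l); exists K.
  have [K HK] := choice (fun p : 'I_n * 'I_n => H p.1 p.2).
  exists (\sum_p `|K p|).
  apply: (near_forall_ord (nbhs_filter y)) => k.
  apply: (near_forall_ord (nbhs_filter y)) => l.
  have := HK (k, l); apply: filterS => z /= /le_trans; apply.
  rewrite (bigD1 (k, l)) //=; apply: le_trans (ler_norm _) _.
  by rewrite lerDl sumr_ge0.
have H : nbhs y (B `&` [set z | forall k l, `|'J F z k l| <= K]) by exact: filterI.
have /nbhs_ballP[s /= s0 sP] := H.
exists (ball y s); first exact: nbhsx_ballx.
exists (n%:R * `|K|) => z w zB wB; apply/mx_norm_le; first by rewrite !mulr_ge0.
move=> i l; rewrite (ord1 i) !mxE.
have := @partials_taylor _ _ (fun z => F z 0 l) y s `|K| (fun=> 0) _ w z wB zB.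
have -> : \sum_k (z 0 k - w 0 k) * 0 = 0 by apply: big1 => k _; rewrite mulr0.
rewrite subr0; apply=> x /sP[Bx /= Kx] k.
have dx : derivable F x (delta_mx 0 k) by exact: diff_derivable (dF x Bx).
split; first by have /derivable_mxP := dx; apply.
have -> : pd k (fun z => F z 0 l) x = 'J F x k l.
  have := deriveEjacobian (delta_mx 0 k) (dF x Bx).
  by rewrite derive_mx// -rowE => /matrixP/(_ 0 l); rewrite !mxE.
by rewrite subr0; apply: le_trans (Kx k l) (ler_norm _).
Qed.

Lemma hoelder_ln_absdet (O : set M) (S : M -> M) (z0 : M) : open O -> O z0 ->
  C1_holder A e O S -> (forall z, O z -> 0 < absdet g S z) ->
  hoelder_at e (fun y => ln (absdet g S (param (chart_at A z0) y))) (coord (chart_at A z0) z0).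
Proof.
move=> Oo Oz SC Spos; set i := chart_at A z0; have iz : dom i z0 := chart_atP A z0.
pose j := chart_at A (S z0); have jz : dom j (S z0) := chart_atP A (S z0).
have [Sc [B By [dF [C JC]]]] := SC z0 Oz.
set F := in_charts A S z0 in dF JC; set y0 := coord i z0 in By *.
have FE : F y0 = coord j (S z0) by rewrite /F /in_charts /= /y0 coordK.
have hJ k l : hoelder_at e (fun z => 'J F z k l) y0.
  exists B => //; exists C => a b Ba Bb; apply: le_trans (JC a b Ba Bb).
  exact: entry_dist_le.
have hGi : hoelder_at e (fun y => \det (gram g i y)) y0.
  apply: hoelder_det => // a b.
  have [B' B'y [C' HC']] := gram_lipschitz a b (cod_coord iz).
  exact: hoelder_lipschitz HC'.
have Fc : {for y0, continuous F}.
  by apply: differentiable_continuous; apply: dF; exact: nbhs_singleton.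
have [BL BLy [CL HL]] := jacobian_lipschitz By dF hJ.
have hGj : hoelder_at e (fun y => \det (gram g j (F y))) y0.
  apply: hoelder_det => // a b.
  have [B' B'y [C' HC']] := gram_lipschitz a b (cod_coord jz).
  rewrite -FE in B'y; have B'F : nbhs y0 (F @^-1` B') := near_continuous Fc B'y.
  apply: (@hoelder_lipschitz _ _ _ e1 _ _ (BL `&` (F @^-1` B')) (`|C'| * CL)).
    exact: filterI.
  move=> z w [zL zB] [wL wB]; apply: le_trans (HC' _ _ zB wB) _.
  apply: le_trans (ler_wpM2r (normr_ge0 _) (ler_norm C')) _.
  by rewrite -mulrA ler_wpM2l// HL.
(* Squaring removes the absolute value of the determinant and the roots in [vol], and [2^-1] undoes
   the square; the arguments of [ln] are then positive determinants with Hoelder entries. *)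
have near_formula : \forall y \near y0, [/\ \det ('J F y) ^+ 2 > 0,
    0 < \det (gram g j (F y)), 0 < \det (gram g i y) &
    ln (absdet g S (param i y)) =
    2^-1 * (ln (\det ('J F y) ^+ 2) + ln (\det (gram g j (F y)))
              - ln (\det (gram g i y)))].
  have H1 : \forall w \near z0, O w /\ dom j (S w).
    apply: filterI; first exact: open_nbhs_nbhs.
    exact: near_continuous Sc (near_dom jz).
  apply: filterS3 (near_cod (cod_coord iz)) By (near_param iz H1) => y iy yB [Oy jSy].
  have [iy' cy] := cod_param iy.
  have Sy := Spos _ Oy; have [Syc _] := SC _ Oy.
  have FJ : map_jacobian S (param i y) i j ('J F y).
    by rewrite /map_jacobian cy; apply/has_jacobianP; split=> //; exact: dF.
  have := absdet_charts g iy' jSy Syc FJ.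
  have -> : coord j (S (param i y)) = F y by [].
  rewrite cy /vol => EQ.
  have Gi := posdef_det (gram_posdef g iy).
  have Gj : 0 < \det (gram g j (F y)) := posdef_det (gram_posdef g (cod_coord jSy)).
  have J0 : 0 < \det ('J F y) ^+ 2.
    rewrite lt_neqAle eq_sym sqrf_eq0 sqr_ge0 andbT.
    by apply: contraTneq Sy => D0; rewrite EQ D0 normr0 !mul0r ltxx.
  split=> //.
  have E2 : absdet g S (param i y) ^+ 2 =
      \det ('J F y) ^+ 2 * \det (gram g j (F y)) / \det (gram g i y).
    rewrite EQ !exprMn exprVn !sqr_sqrtr ?(ltW Gi) ?(ltW Gj)//.
    by rewrite real_normK ?num_real.
  have L2 : ln (absdet g S (param i y) ^+ 2) = ln (\det ('J F y) ^+ 2)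
      + ln (\det (gram g j (F y))) - ln (\det (gram g i y)).
    by rewrite E2 ln_div ?posrE ?(mulr_gt0 J0 Gj)// lnM ?posrE.
  by rewrite -L2 (lnXn 2 Sy) -[ln _ *+ 2]mulr_natl mulKf.
have F0 := nbhs_singleton near_formula; have [J0 Gj0 Gi0 _] := F0.
have hsum : hoelder_at e (fun y => 2^-1 * (ln (\det ('J F y) ^+ 2)
   + ln (\det (gram g j (F y))) - ln (\det (gram g i y)))) y0.
  apply: hoelderM => //; first exact: hoelder_cst.
  apply: hoelderD; last by apply: hoelderN => //; exact: hoelder_ln.
  apply: hoelderD; last exact: hoelder_ln.
  apply: hoelder_ln => //.
  by apply: eq_hoelder_at (hoelderM e0 (hoelder_det e0 e1 hJ) (hoelder_det e0 e1 hJ)).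
have [BS BSy [CS HS]] := hsum.
exists (BS `&` [set y | ln (absdet g S (param i y)) = 2^-1 * (ln (\det ('J F y) ^+ 2)
   + ln (\det (gram g j (F y))) - ln (\det (gram g i y)))]).
  by apply: filterI => //; apply: filterS near_formula => y [].
by exists CS => a b [aS /= ->] [bS /= ->]; exact: HS.
Qed.

End HoelderAbsdet.

(** * Bounded distortion *)

(** As [Q] is monotone in the constant, finitely many local constants have a common bound;
    compactness enters as the near-covering property along the filter at infinity. *)
Lemma compact_uniform (R : realType) (T : topologicalType) (W : set T) (Q : T -> R -> Prop) :
  compact W -> (forall x c c', c <= c' -> Q x c -> Q x c') ->
  (forall x, W x -> exists c, \forall x' \near x, Q x' c) ->
  exists c, forall x, W x -> Q x c.
Proof.
move=> /compact_near_coveringP cW Qmono Qloc.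
have H : \forall c \near (+oo : set_system R), forall x, W x -> Q x c.
  apply: (cW R (+oo : set_system R) (fun c x => Q x c)) => x Wx.
  have [c Qc] := Qloc x Wx.
  exists ([set x' | Q x' c], [set c' | c <= c']).
    by split; [exact: Qc|apply: nbhs_pinfty_ge; exact: num_real].
  by move=> [x' c'] /= [Qx cc']; exact: Qmono cc' Qx.
by near (+oo : set_system R) => c; exists c; near: c.
Unshelve. all: by end_near. Qed.

Section BoundedDistortion.
Context (R : realType) (n : nat) (M : topologicalType) (A : smooth_atlas R n M).
Context (g : riemannian_metric A) (M_hausdorff : hausdorff_space M).
Context (N : nat) (U W : set M) (S : 'I_N -> M -> M).
Context (U_open : open U) (U_connected : connected U) (W_compact : compact W).
Context (W_sub : W `<=` U) (S_cifs : cifs g U W S).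
Implicit Types (i : 'I_N) (u v : seq 'I_N) (x y z : M).
Notation dual := (dual_le g U).

Lemma local_dual_bound z : U z -> exists c, \forall z' \near z, dual z z' c.
Proof.
move=> Uz; have iz := chart_atP A z.
have [s [C GB]] := good_ball_exists g iz (open_nbhs_nbhs (conj U_open Uz)).
have s4 : 0 < 4 * s by rewrite mulr_gt0// (good_radius GB).
exists (C * (4 * s)).
have H : \forall z' \near z, ball (coord (chart_at A z) z) (4 * s) (coord (chart_at A z) z').
  by apply: near_coord => //; exact: nbhsx_ballx.
apply: filterS2 (near_dom iz) H => z' iz' yz' f uf.
have := good_lipschitz GB uf yz' (ballxx _ s4); rewrite !coordK//.
move=> /le_trans; apply; rewrite ler_wpM2l ?(ltW (good_const GB))//.
by move: yz'; rewrite mx_norm_ball => /ltW.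
Qed.

(** By the local bound, the points of [U] at finite dual distance from [x] form a set that is open
    and closed in [U]. *)
Lemma dual_bound_connected x y : U x -> U y -> exists c, dual x y c.
Proof.
move=> Ux Uy; pose B := [set z | U z /\ exists c, dual x z c].
suff BE : B = U by have [] : B y by rewrite BE.
have openB : open B.
  rewrite openE => z [Uz [c xz]].
  have [c' H] := local_dual_bound Uz.
  apply: filterS2 (open_nbhs_nbhs (conj U_open Uz)) H => z' Uz' zz'.
  by split=> //; exists (c + c'); exact: dual_le_trans xz zz'.
apply: U_connected.
- by exists x; split=> //; exists 0; exact: dual_le_refl.
- by exists B => //; rewrite setIidr// => z [].
exists (~` [set z | U z /\ ~ exists c, dual x z c]); last first.
  apply/seteqP; split=> z; first by move=> [Uz xz]; split=> // -[].
  by move=> [Uz /= nz]; split=> //; apply: contrapT => h; apply: nz.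
apply: open_closedC; rewrite openE => z [Uz nz].
have [c' H] := local_dual_bound Uz.
apply: filterS2 (open_nbhs_nbhs (conj U_open Uz)) H => z' Uz' zz'.
split=> // -[c xz']; apply: nz; exists (c + c').
by apply: dual_le_trans xz' (dual_le_sym zz').
Qed.

Lemma dual_bound_compact : exists c, forall x y, W x -> W y -> dual x y c.
Proof.
have [[x0 Wx0]|W0] := pselect (exists x, W x); last first.
  by exists 0 => x y Wx; case: W0; exists x.
have [c cP] : exists c, forall x, W x -> dual x0 x c.
  apply: (@compact_uniform _ _ W (fun x c => dual x0 x c)) => //.
    by move=> x c c' cc'; exact: dual_le_mono.
  move=> x Wx; have [c1 xc] := dual_bound_connected (W_sub Wx0) (W_sub Wx).
  have [c2 xc2] := local_dual_bound (W_sub Wx).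
  exists (c1 + c2); apply: filterS xc2 => x' xx'.
  exact: dual_le_trans xc xx'.
exists (c + c) => x y Wx Wy.
exact: dual_le_trans (dual_le_sym (cP x Wx)) (cP y Wy).
Qed.

Lemma cifs_U i z : U z -> U (S i z).
Proof. by move=> Uz; have [/(_ i)[SU _ _] _ _] := S_cifs; apply: SU; exists z. Qed.

Lemma cifs_W i z : W z -> W (S i z).
Proof. by move=> Wz; have [_ /(_ i) SW _] := S_cifs; apply: SW; exists z. Qed.

Lemma cifs_absdet i z : U z -> 0 < absdet g (S i) z < 1.
Proof. by have [_ _ H] := S_cifs; exact: H. Qed.

Lemma cifs_exponent i : exists2 e : R, 0 < e < 1 & C1_holder_diffeo A e U (S i).
Proof. by have [/(_ i)[_ _ H] _ _] := S_cifs. Qed.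

Lemma cifs_mdiff i z : U z -> mdiff A (S i) z.
Proof. by have [e _ [H _ _]] := cifs_exponent i; exact: C1_holder_mdiff H. Qed.

Definition stretch (f : M -> M) z : R := absdet g f z `^ n%:R^-1.

(** The conformal ratio is the [n]-th root of the determinant by [conformal_absdet]. *)
Lemma cifs_stretch i z : U z -> 0 < stretch (S i) z < 1 /\
  forall v : 'rV[R]_n, tnorm g (S i z) (v *m dmap A (S i) z) = stretch (S i) z * tnorm g z v.
Proof.
move=> Uz; have [/(_ i)[_ Sc _] _ _] := S_cifs; have [r r0 rP] := Sc z Uz.
have aE := conformal_absdet r0 rP; have := cifs_absdet i Uz; rewrite aE => /andP[_ r1].
(* In dimension zero the determinant would be [r ^+ 0 = 1], against condition (c) of a CIFS. *)
have n0 : n%:R != 0 :> R.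
  by rewrite pnatr_eq0; apply: contraTneq r1 => ->; rewrite expr0 ltxx.
have -> : stretch (S i) z = r.
  by rewrite /stretch aE -powR_mulrn ?(ltW r0)// -powRrM mulfV// powRr1// ltW.
split=> //; rewrite r0 /= ltNge; apply: contraTN r1 => r1.
by rewrite -leNgt exprn_ege1.
Qed.

Lemma cifs_stretch_le i z : U z -> stretch_le g (S i) z (stretch (S i) z).
Proof.
move=> Uz; have [/andP[r0 _] rP] := cifs_stretch i Uz; have dS := cifs_mdiff i Uz.
by split; [exact: dS.1|exact: near_conformal_qdist].
Qed.

Lemma stretch_expR i z : U z -> stretch (S i) z = expR (n%:R^-1 * ln (absdet g (S i) z)).
Proof. by move=> Uz; rewrite /stretch /powR gt_eqF//; case/andP: (cifs_absdet i Uz). Qed.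

(* One constant [c] controls both the contraction factor [1 - 1/c] of the dual
   distance and the Hoelder constant of the logarithm of the Jacobian. *)
Definition contraction_bound i e x c : Prop := 0 < c /\ forall y D, W y -> dual x y D ->
  dual (S i x) (S i y) ((1 - c^-1) * D) /\
  `|ln (absdet g (S i) x) - ln (absdet g (S i) y)| <= c * D `^ e.

Lemma contraction_bound_mono i e x c c' : W x -> c <= c' ->
  contraction_bound i e x c -> contraction_bound i e x c'.
Proof.
move=> Wx cc' [c0 H]; split; first exact: lt_le_trans cc'.
move=> y D Wy xy; have [H1 H2] := H y D Wy xy; have D0 := dual_le_ge0 xy.
split.
  apply: dual_le_mono H1; rewrite ler_wpM2r// lerD2l lerN2 lef_pV2 ?posrE//.
  exact: lt_le_trans cc'.
by apply: (le_trans H2); rewrite ler_wpM2r// powR_ge0.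
Qed.

Section OneMap.
Context (i : 'I_N) (e : R) (e0 : 0 < e) (e1 : e < 1) (Se : C1_holder A e U (S i)).

Let absdet_gt0 z : U z -> 0 < absdet g (S i) z.
Proof. by move=> /(cifs_absdet i)/andP[]. Qed.

Lemma ln_absdet_bounded : exists c, forall x, W x -> `|ln (absdet g (S i) x)| <= c.
Proof.
apply: (@compact_uniform _ _ W (fun x c => `|ln (absdet g (S i) x)| <= c)) => //.
  by move=> x c c' cc' /le_trans; apply.
move=> x Wx; have ix := chart_atP A x.
have H := hoelder_ln_absdet e0 (ltW e1) U_open (W_sub Wx) Se absdet_gt0.
have [c _ cP] := hoelder_bounded e0 H.
by exists c; apply: filterS2 (near_dom ix) (near_coord ix cP) => z iz; rewrite coordK.
Qed.

(** Writing the bound as [- c^-1] makes it weaker as [c] grows, as [compact_uniform] requires. *)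
Lemma ln_absdet_lt0 :
  exists c, forall x, W x -> 0 < c /\ ln (absdet g (S i) x) <= - c^-1.
Proof.
apply: (@compact_uniform _ _ W (fun x c => 0 < c /\ ln (absdet g (S i) x) <= - c^-1)) => //.
  move=> x c c' cc' [c0 /le_trans H]; have c'0 := lt_le_trans c0 cc'.
  by split=> //; apply: H; rewrite lerN2 lef_pV2.
move=> x Wx; have ix := chart_atP A x; have Ux := W_sub Wx.
have l0 : 0 < - ln (absdet g (S i) x) by rewrite oppr_gt0 ln_lt0// cifs_absdet.
have l2 : 0 < - ln (absdet g (S i) x) / 2 by rewrite divr_gt0.
have H := hoelder_continuous e0 (hoelder_ln_absdet e0 (ltW e1) U_open Ux Se absdet_gt0) l2.
exists (- ln (absdet g (S i) x) / 2)^-1.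
apply: filterS2 (near_dom ix) (near_coord ix H) => z iz; rewrite !coordK// invrK.
by rewrite invr_gt0 l2 ler_norml; split=> //; lra.
Qed.

Lemma local_contraction_bound x0 : W x0 ->
  exists c, \forall x \near x0, W x -> contraction_bound i e x c.
Proof.
move=> Wx0; have ix := chart_atP A x0; have Ux0 := W_sub Wx0.
set j := chart_at A x0 in ix.
pose h (a : 'rV[R]_n) := ln (absdet g (S i) (param j a)).
have Hh : hoelder_at e h (coord j x0).
  exact: (hoelder_ln_absdet e0 (ltW e1) U_open Ux0 Se absdet_gt0).
have [DW DWP] := dual_bound_compact; have [L LP] := ln_absdet_bounded.
have n0 : (0 < n)%N.
  rewrite lt0n; apply/eqP => n0; have nV : n%:R^-1 = 0 :> R by rewrite n0 invr0.
  by have [/andP[_ +] _] := cifs_stretch i Ux0; rewrite /stretch nV powRr0 ltxx.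
pose l0 := ln (absdet g (S i) x0).
have l00 : l0 < 0 by apply: ln_lt0; exact: cifs_absdet.
have l02 : 0 < - l0 / 2 by rewrite divr_gt0// oppr_gt0.
(* The stretch at [x0] is the exponential of [n%:R^-1 * l0]; halving this negative exponent leaves
   room for a neighborhood. *)
pose r := expR (n%:R^-1 * (l0 / 2)).
have r01 : 0 <= r < 1.
  rewrite expR_ge0 /= expR_lt1 pmulr_rlt0 ?invr_gt0 ?ltr0n//; lra.
pose V := [set z | U z /\ stretch (S i) z <= r].
have Vx : nbhs x0 V.
  have H1 := near_coord ix (hoelder_continuous e0 Hh l02).
  apply: filterS3 (open_nbhs_nbhs (conj U_open Ux0)) (near_dom ix) H1 => z Uz iz.
  rewrite /h !coordK// -/l0 => H1; split=> //; rewrite stretch_expR// ler_expR.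
  by rewrite ler_wpM2l ?invr_ge0//; move: H1; rewrite ler_norml; lra.
have VU : V `<=` U by move=> z [].
have [s1 [C GB1]] := good_ball_exists g ix Vx.
have [B By [CH HB]] := Hh.
have /nbhs_ballP[sB /= sB0 sBP] := By.
(* The ball of radius [4 * s] also has to lie in [B], where the Hoelder estimate holds. *)
pose s := Num.min s1 (sB / 4).
have s0 : 0 < s by rewrite lt_min (good_radius GB1) divr_gt0.
have GB : good_ball g j (coord j x0) V s C.
  by apply: good_ballW GB1 => //; rewrite ge_min lexx.
have sB4 (a : 'rV[R]_n) : ball (coord j x0) (4 * s) a -> B a.
  move=> ys; apply: sBP; apply: le_ball ys.
  by rewrite mulrC -ler_pdivlMr// ge_min lexx orbT.
have C0 := good_const GB.
(* [K^-1] is the gain in [dual_le_contraction]. In [H], the constant [CH] serves the points within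
   distance [s] and the term with [L] all others; the power of [C] converts the bump into the dual
   distance. *)
pose K := C * (C + DW / s + C^-1) / (1 - r).
pose H := (`|CH| + 2 * `|L| / s `^ e) * C `^ e.
exists (1 + `|K| + `|H|).
have H2 : \forall x \near x0, ball (coord j x0) s (coord j x).
  by apply: near_coord => //; exact: nbhsx_ballx.
apply: filterS2 (near_dom ix) H2 => x jx bx Wx.
have c0 : 0 < 1 + `|K| + `|H| by rewrite -addrA ltr_pwDl// addr_ge0.
split=> // y D Wy xy; have D0 := dual_le_ge0 xy.
have /andP[r0 r1] := r01; have DW0 := dual_le_ge0 (DWP x x Wx Wx).
have K0 : 0 < K.
  rewrite divr_gt0 ?subr_gt0// mulr_gt0// ltr_wpDr ?invr_ge0 ?(ltW C0)//.
  by rewrite ltr_wpDr// divr_ge0// ltW.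
split.
  have SU z : U z -> [/\ U (S i z), stretch_le g (S i) z (stretch (S i) z)
      & 0 <= stretch (S i) z <= 1].
    move=> Uz; split; [exact: cifs_U|exact: cifs_stretch_le|].
    by have [/andP[/ltW-> /ltW->]] := cifs_stretch i Uz.
  apply: dual_le_mono (dual_le_contraction M_hausdorff GB VU jx bx SU _ r01 (DWP x y Wx Wy) xy).
    rewrite ler_wpM2r// lerD2l lerN2.
    have -> : (1 - r) / (C * (C + DW / s + C^-1)) = K^-1 by rewrite /K invf_div.
    rewrite lef_pV2 ?posrE//; apply: le_trans (ler_norm _) _.
    by rewrite addrAC addrC lerDl addr_ge0.
  by move=> z [].
apply: le_trans (_ : H * D `^ e <= _); last first.
  rewrite ler_wpM2r ?powR_ge0//; apply: le_trans (ler_norm _) _.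
  by rewrite lerDr addr_ge0.
have bD := dual_le_bump M_hausdorff GB jx bx xy.
have b0 := bump_ge0 GB x y.
have s0e : 0 < s `^ e by exact: powR_gt0.
have be : bump j (coord j x0) s x y `^ e <= C `^ e * D `^ e.
  rewrite -powRM ?(ltW C0)//; apply: ge0_ler_powR; rewrite ?nnegrE// ?(ltW e0)//.
  by rewrite mulr_ge0// ltW.
apply: le_trans (_ : (`|CH| + 2 * `|L| / s `^ e) * bump j (coord j x0) s x y `^ e <= _); last first.
  by rewrite /H -[leRHS]mulrA ler_wpM2l// addr_ge0// divr_ge0 ?powR_ge0// mulr_ge0.
(* Where the bump equals [s], the bound of the logarithm on [W] suffices. *)
have far : `|ln (absdet g (S i) x) - ln (absdet g (S i) y)| <=
    (`|CH| + 2 * `|L| / s `^ e) * s `^ e.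
  apply: le_trans (ler_normB _ _) _; rewrite mulrDl divfK ?gt_eqF//.
  have := le_trans (LP x Wx) (ler_norm L); have := le_trans (LP y Wy) (ler_norm L).
  have : 0 <= `|CH| * s `^ e by rewrite mulr_ge0// ltW.
  lra.
rewrite /bump; case: asboolP => [[jy by_]|//].
have [lts|//] := leP `|coord j y - coord j x| s.
apply: le_trans (_ : CH * `|coord j y - coord j x| `^ e <= _).
  rewrite -[X in absdet g (S i) X](coordK jx) -[X in _ - ln (absdet g (S i) X)](coordK jy).
  rewrite distrC; apply: HB; apply: sB4.
    by apply: le_ball by_; lra.
  by apply: le_ball bx; lra.
rewrite ler_wpM2r ?powR_ge0//; apply: le_trans (ler_norm _) _.
by rewrite lerDl divr_ge0 ?mulr_ge0// ltW.
Qed.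

Lemma uniform_contraction_bound : exists c, forall x, W x -> contraction_bound i e x c.
Proof.
(* [W x] is made part of the predicate because the neighborhoods in [compact_uniform] may contain
   points outside [W]. *)
have [c cP] : exists c, forall x, W x -> W x -> contraction_bound i e x c.
  apply: (@compact_uniform _ _ W (fun x c => W x -> contraction_bound i e x c)) => //.
    by move=> x c c' cc' H Wx; apply: contraction_bound_mono (H Wx).
  exact: local_contraction_bound.
by exists c => x Wx; exact: cP.
Qed.

End OneMap.

Lemma cifs_contraction : exists (e : 'I_N -> R) (c : R), 1 < c /\
  forall i, 0 < e i < 1 /\ forall x, W x -> contraction_bound i (e i) x c.
Proof.
have H i : exists p : R * R, 0 < p.1 < 1 /\ forall x, W x -> contraction_bound i p.1 x p.2.
  have [e /andP[e0 e1] [Se _ _]] := cifs_exponent i.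
  have [c cP] := uniform_contraction_bound e0 e1 Se.
  by exists (e, c); split=> //=; rewrite e0.
have [p pP] := choice H.
exists (fun i => (p i).1), (2 + \sum_i `|(p i).2|); split.
  by rewrite ltr_wpDr ?sumr_ge0// ltr1n.
move=> i; have [ei ci] := pP i; split=> // x Wx.
apply: contraction_bound_mono (ci x Wx) => //; apply: le_trans (ler_norm _) _.
by rewrite (bigD1 i) //= addrCA lerDl addr_ge0// sumr_ge0.
Qed.

(** * Jacobians of word maps and their distortion *)

Lemma word_map_U u z : U z -> U (word_map S u z).
Proof. by move=> Uz; elim: u => //= i u IH; exact: cifs_U. Qed.

Lemma word_map_W u z : W z -> W (word_map S u z).
Proof. by move=> Wz; elim: u => //= i u IH; exact: cifs_W. Qed.

Lemma word_map_cat u v z : word_map S (u ++ v) z = word_map S u (word_map S v z).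
Proof. by elim: u => //= i u ->. Qed.

Lemma word_map_mdiff u z : U z -> mdiff A (word_map S u) z.
Proof.
move=> Uz; elim: u => [|i u IH]; first exact: (mdiff_id A z).1.
by have [] := mdiff_comp IH (cifs_mdiff i (word_map_U u Uz)).
Qed.

Lemma absdet_cat u v z : U z -> absdet g (word_map S (u ++ v)) z =
  absdet g (word_map S u) (word_map S v z) * absdet g (word_map S v) z.
Proof.
move=> Uz; have -> : word_map S (u ++ v) = word_map S u \o word_map S v.
  by apply/funext => x /=; rewrite word_map_cat.
by apply: absdet_comp; apply: word_map_mdiff => //; exact: word_map_U.
Qed.

Lemma absdet_cons i u z : U z -> absdet g (word_map S (i :: u)) z =
  absdet g (S i) (word_map S u z) * absdet g (word_map S u) z.
Proof. by move=> Uz; rewrite -cat1s absdet_cat. Qed.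

Lemma absdet_word_gt0 u z : U z -> 0 < absdet g (word_map S u) z.
Proof.
move=> Uz; elim: u => [|i u IH]; first by rewrite absdet_id.
rewrite absdet_cons// mulr_gt0//.
by have /andP[] := cifs_absdet i (word_map_U u Uz).
Qed.

Lemma absdet_word_le1 u z : U z -> absdet g (word_map S u) z <= 1.
Proof.
move=> Uz; elim: u => [|i u IH]; first by rewrite absdet_id.
have /andP[a0 a1] := cifs_absdet i (word_map_U u Uz).
by rewrite absdet_cons// mulr_ile1 ?(ltW a0) ?(ltW a1)// ltW// absdet_word_gt0.
Qed.

Lemma cifs_absdet_bounds : exists m r : R, [/\ 0 < m, m <= 1, 0 < r < 1 &
  forall i x, W x -> m <= absdet g (S i) x <= r].
Proof.
have H i : exists c, 0 < c /\ forall x, W x ->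
    - c <= ln (absdet g (S i) x) <= - c^-1.
  have [e /andP[e0 e1] [Se _ _]] := cifs_exponent i.
  have [c cP] := ln_absdet_bounded e0 e1 Se; have [c' c'P] := ln_absdet_lt0 e0 e1 Se.
  exists (1 + `|c| + `|c'|); split=> [|x Wx]; first by rewrite -addrA ltr_pwDl// addr_ge0.
  have H1 := cP x Wx; have [c'0 H2] := c'P x Wx.
  move: H1; rewrite ler_norml => /andP[H1 _]; apply/andP; split.
    by have := ler_norm c; have := normr_ge0 c'; lra.
  apply: (le_trans H2); rewrite lerN2 lef_pV2 ?posrE ?(gtr0_norm c'0)//.
    by have := normr_ge0 c; lra.
  by have := normr_ge0 c; lra.
have [c cP] := choice H; pose C := 1 + \sum_i c i.
have c0 i : 0 < c i by have [] := cP i.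
have C1 : 0 < C by rewrite ltr_pwDl// sumr_ge0// => i _; exact: ltW.
exists (expR (- C)), (expR (- C^-1)); split.
- exact: expR_gt0.
- by rewrite expR_le1 oppr_le0 ltW.
- by rewrite expR_gt0 expR_lt1 oppr_lt0 invr_gt0.
move=> i x Wx; have [_ /(_ x Wx)/andP[H1 H2]] := cP i.
have ciC : c i <= C.
  by rewrite /C (bigD1 i) //= addrCA lerDl addr_ge0// sumr_ge0// => j _; exact: ltW.
have /andP[a0 _] := cifs_absdet i (W_sub Wx).
rewrite -(lnK (a0 : _ \in Num.pos)) !ler_expR; apply/andP; split.
  by apply: le_trans H1; rewrite lerN2.
by apply: (le_trans H2); rewrite lerN2 lef_pV2 ?posrE.
Qed.

(** Induction on the word: the dual distance of the two orbits shrinks by [th] with every letter, so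
    the letter added to a word of length [k] changes the logarithm of the quotient by at most a
    constant times [q ^+ k]. *)
Lemma bounded_distortion : exists2 B : R, 0 < B & forall u x y, W x -> W y ->
  absdet g (word_map S u) x <= B * absdet g (word_map S u) y.
Proof.
have [e [c [c1 cP]]] := cifs_contraction; have [DW DWP] := dual_bound_compact.
have c0 : 0 < c := lt_trans ltr01 c1.
pose th := 1 - c^-1.
have th0 : 0 < th by rewrite subr_gt0 invf_lt1.
have th1 : th < 1 by rewrite ltrBlDr ltrDl invr_gt0.
(* The Hoelder exponents depend on the letter; since powers of [th] are at most 1, the smallest
   exponent serves for all. *)
pose em := \big[Num.min/1]_i e i.
have em0 : 0 < em.
  rewrite /em; elim/big_ind: _ => // [a b a0 b0|i _]; first by rewrite lt_min a0.
  by have [/andP[]] := cP i.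
have eme i : em <= e i by exact: bigmin_le.
pose q := th `^ em.
have q0 : 0 < q by exact: powR_gt0.
have q1 : q < 1.
  rewrite /q /powR gt_eqF// expR_lt1 pmulr_rlt0// ln_lt0// th0 th1 //.
(* [E * (1 - q ^+ k)] is the sum of the first [k] terms [c * (1 + DW) * q ^+ j]. *)
pose E := c * (1 + DW) / (1 - q).
have q1' : 0 < 1 - q by rewrite subr_gt0.
suff key u x y : W x -> W y ->
    dual (word_map S u x) (word_map S u y) (th ^+ size u * DW) /\
    `|ln (absdet g (word_map S u) x) - ln (absdet g (word_map S u) y)|
      <= E * (1 - q ^+ size u).
  exists (expR E); first exact: expR_gt0.
  move=> u x y Wx Wy; have [_ H] := key u x y Wx Wy.
  have ax := absdet_word_gt0 u (W_sub Wx); have ay := absdet_word_gt0 u (W_sub Wy).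
  rewrite -(lnK (ax : _ \in Num.pos)) -[X in _ * X](lnK (ay : _ \in Num.pos)) -expRD ler_expR.
  rewrite -lerBlDr; apply: le_trans (ler_norm _) _; apply: (le_trans H).
  rewrite ler_piMr//; last by rewrite lerBlDr lerDl exprn_ge0// ltW.
  rewrite divr_ge0 ?(ltW q1')// mulr_ge0 ?(ltW c0)// addr_ge0//.
  exact: dual_le_ge0 (DWP x x Wx Wx).
move=> Wx Wy; have DW0 := dual_le_ge0 (DWP x x Wx Wx).
elim: u => [|i u [IHd IHa]].
  rewrite /= !absdet_id subrr normr0 expr0 mul1r subrr mulr0.
  by split=> //; exact: DWP.
have Wux := word_map_W u Wx; have Wuy := word_map_W u Wy.
have [/andP[ei0 ei1] /(_ _ Wux)[_ H]] := cP i; have [Hd Ha] := H _ _ Wuy IHd.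
split; first by rewrite /= exprS -mulrA.
rewrite (absdet_cons i u (W_sub Wx)) (absdet_cons i u (W_sub Wy)).
have pos z : W z -> absdet g (word_map S u) z \in Num.pos.
  by move=> Wz; rewrite posrE absdet_word_gt0//; exact: W_sub.
have posi z : W z -> absdet g (S i) z \in Num.pos.
  by move=> /W_sub/(cifs_absdet i)/andP[].
rewrite (lnM (posi _ Wux) (pos _ Wx)) (lnM (posi _ Wuy) (pos _ Wy)).
(* Passing from [DW] to [1 + DW], which is at least 1, allows the exponent [e i <= 1] to be
   dropped. *)
have le_q : c * (th ^+ size u * DW) `^ e i <= c * (1 + DW) * q ^+ size u.
  rewrite -mulrA ler_wpM2l ?(ltW c0)// powRM ?exprn_ge0 ?(ltW th0)// mulrC.
  apply: ler_pM; rewrite ?powR_ge0//.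
    apply: le_trans (_ : (1 + DW) `^ e i <= _).
      by apply: ge0_ler_powR; rewrite ?nnegrE ?addr_ge0 ?lerDr// ltW.
    by apply: ler1_powR; rewrite ?lerDl// ltW.
  have tk : 0 < th ^+ size u <= 1 by rewrite exprn_gt0// exprn_ile1 ?(ltW th0)// ltW.
  apply: le_trans (ger_powR tk (eme i)) _.
  by rewrite -[th ^+ _](powR_mulrn _ (ltW th0)) powRAC powR_mulrn// ltW.
have alg (a b a' b' : R) : a + b - (a' + b') = (a - a') + (b - b') by lra.
rewrite alg.
apply: le_trans (ler_normD _ _) _; apply: le_trans (lerD (le_trans Ha le_q) IHa) _.
rewrite exprS le_eqVlt; apply/orP; left; apply/eqP; rewrite /E; field.
by rewrite gt_eqF.
Qed.

End BoundedDistortion.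

(** * Counting maps by types *)

Lemma finite_uniform (T : Type) (C : set T) (Q : T -> nat -> Prop) :
  finite_set C -> (forall x c c', (c <= c')%N -> Q x c -> Q x c') ->
  (forall x, C x -> exists c, Q x c) -> exists c, forall x, C x -> Q x c.
Proof.
elim/Pchoice: T => T in C Q *; move=> /finite_seqP[s ->] Qmono QC.
elim: s QC => [|x s IH] QC; first by exists 0%N.
have [c1 H1] : exists c, Q x c by apply: QC; rewrite /= inE eqxx.
have [c2 H2] : exists c, forall x, [set` s] x -> Q x c.
  by apply: IH => y /= ys; apply: QC; rewrite /= inE ys orbT.
exists (c1 + c2)%N => y; rewrite /= inE => /predU1P[->|ys].
  by apply: Qmono H1; rewrite leq_addr.
by apply: Qmono (H2 y ys); rewrite leq_addl.
Qed.

Lemma prefix_comparable (T : eqType) (u v w : seq T) :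
  prefix u w -> prefix v w -> (size u <= size v)%N -> prefix u v.
Proof.
rewrite !prefixE => /eqP uw /eqP vw uv.
by rewrite -[X in take _ X]vw take_takel// uw.
Qed.

Lemma finite_short_words (N V : nat) : finite_set [set v : seq 'I_N | (size v <= V)%N].
Proof.
have -> : [set v : seq 'I_N | (size v <= V)%N] =
    \bigcup_(k in `I_V.+1) [set tval t | t in [set: k.-tuple 'I_N]].
  apply/seteqP; split=> [v vV|v [k kV [t _ <-]]]; last by rewrite /= size_tuple -ltnS.
  by exists (size v) => //; exists (in_tuple v).
apply: bigcup_finite; first exact: finite_II.
by move=> k _; apply: finite_image; exact: finite_finset.
Qed.

(** * A common level of the nested index sets *)

Section NestedWords.
Context (N : nat) (K : nat -> {fset (seq 'I_N)}) (K_nested : nested_index_sets K).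
Implicit Types (u v w : seq 'I_N) (k : nat).

Lemma size_le_max_len k w : w \in K k -> (size w <= max_len (K k))%N.
Proof. by move=> wK; rewrite /max_len (big_fsetD1 w)//= leq_maxl. Qed.

Lemma min_len_le_size k w : w \in K k -> (min_len (K k) <= size w)%N.
Proof. have -> : (w \in K k) = (w \in enum_fset (K k)) by [].
rewrite /min_len; move: (max_len _) => m; elim: (enum_fset (K k)) => // u s IH.
by rewrite inE big_cons geq_min => /predU1P[->|/IH ->]; rewrite ?leqnn ?orbT. Qed.

Definition cut k u : Prop :=
  exists w, [/\ w \in K k, prefix w u & (size w < size u)%N].

(* The levels need not refine each other; the first level that fails to cut
   some word of [Q] replaces the common refinement. *)
Lemma common_level (Q : set (seq 'I_N)) : Q !=set0 ->
  (forall u, Q u -> (0 < size u)%N) -> (0 < N)%N ->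
  exists k, (forall u, Q u -> cut k u) /\
    exists u w, [/\ Q u, w \in K k, prefix w u &
      forall L, (forall k u v, u \in K k -> v \in K k.+1 -> prefix u v ->
         (size v - size u <= L)%N) -> (size u - size w <= L)%N].
Proof.
move=> [u0 Qu0] Q0 N0; pose i0 := Ordinal N0.
pose fails k := `[< exists u, Q u /\ ~ cut k u >].
(* Once all words of a level are at least as long as [u0], none of them is a proper prefix of
   [u0]. *)
have ex : exists k, fails k.
  have [k _ /(_ k (leqnn k)) /= kP] : \forall k \near \oo, (size u0 <= min_len (K k))%N.
    exact: (cvgnyPge _).1 (nested_min_oo K_nested) _.
  exists k; apply/asboolP; exists u0; split=> // -[w [wK _]].
  by rewrite ltnNge (leq_trans kP)// min_len_le_size.
case: (ex_minnP ex) => k1 /asboolP[u1 [Qu1 nc]] kmin.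
have cut0 u : Q u -> cut 0 u.
  by move=> Qu; exists [::]; rewrite (nested0 K_nested) in_fset1 prefix0s Q0.
case: k1 nc kmin => [|k] nc kmin; first by case: nc; exact: cut0.
have cutk u : Q u -> cut k u.
  move=> Qu; apply: contrapT => ncu.
  by have := kmin k; rewrite ltnn => H; apply: notF; apply: H; apply/asboolP; exists u.
exists k; split=> //; have [w [wK wu ws]] := cutk u1 Qu1.
exists u1, w; split=> // L LP.
(* Padding [u1] beyond [max_len] yields a word [w'] of the next level that is comparable with [u1].
   As that level does not cut [u1], [w'] is no shorter than [u1], and the gap from [w] to [w']
   bounds the rest of [u1]. *)
pose ext := u1 ++ nseq (max_len (K k.+1)).+1 i0.
have [w' w'K w'e] : exists2 w', w' \in K k.+1 & prefix w' ext.
  apply: (nested_above K_nested); rewrite /ext size_cat size_nseq.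
  by rewrite addnS ltnS leq_addl.
have ue : prefix u1 ext by exact: prefix_prefix.
have uw' : (size u1 <= size w')%N.
  rewrite leqNgt; apply/negP => lt; apply: nc; exists w'; split=> //.
  by apply: prefix_comparable w'e ue _; exact: ltnW.
apply: leq_trans (leq_sub2r _ uw') (LP k w w' wK w'K _).
apply: prefix_comparable (prefix_trans wu ue) w'e _.
exact: leq_trans (ltnW ws) uw'.
Qed.

End NestedWords.

(** * Comparison of Jacobians within a type and the bound on the number of maps *)

Section FiniteTypeCounting.
Context (R : realType) (n : nat) (M : topologicalType) (A : smooth_atlas R n M).
Context (g : riemannian_metric A) (M_hausdorff : hausdorff_space M).
Context (N : nat) (U W : set M) (S : 'I_N -> M -> M).
Context (U_open : open U) (U_connected : connected U) (W_compact : compact W).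
Context (W_sub : W `<=` U) (S_cifs : cifs g U W S).
Context (Omega : set M) (Omega_open : open Omega) (Omega_nonempty : Omega !=set0).
Context (Omega_sub : Omega `<=` W) (Omega_invariant : forall i, S i @` Omega `<=` Omega).
Implicit Types (i : 'I_N) (u v w a b : seq 'I_N) (x y z p q : M).

Lemma word_map_Omega u p : Omega p -> Omega (word_map S u p).
Proof. by move=> Op; elim: u => //= i u IH; apply: Omega_invariant; exists (word_map S u p). Qed.

Lemma cifs_inverse i x : U x -> exists h : M -> M,
  [/\ forall y, U y -> h (S i y) = y, mdiff A h (S i x) &
      \forall z \near S i x, S i (h z) = z].
Proof.
move=> Ux; have [e _ [_ So [h [hK hC]]]] := cifs_exponent S_cifs i.
have Sx : (S i @` U) (S i x) by exists x.
exists h; split=> //; first exact: C1_holder_mdiff hC Sx.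
apply: filterS (open_nbhs_nbhs (conj So Sx)) => z [y Uy <-].
by rewrite hK.
Qed.

(** The inverses of the letters compose to a differentiable local inverse at the image point, by
    which [absdet_type] factors one word map through another. *)
Lemma word_map_inverse u x : U x -> exists h : M -> M,
  [/\ h (word_map S u x) = x, mdiff A h (word_map S u x) &
      \forall z \near word_map S u x, word_map S u (h z) = z].
Proof.
move=> Ux; elim: u => [|i u [h [hx hd hn]]].
  by exists id; split=> //; [exact: (mdiff_id A x).1|near=> z].
have [k [kK kd kn]] := cifs_inverse i (word_map_U S_cifs u Ux).
have Uux := word_map_U S_cifs u Ux.
have kx : k (S i (word_map S u x)) = word_map S u x by exact: kK.
exists (h \o k); split.
- by rewrite /= kx.
- by apply: (mdiff_comp kd _).1; rewrite kx.
rewrite -kx in hn; apply: filterS2 kn (near_continuous kd.1 hn) => z Sk Sh /=.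
by rewrite Sh.
Unshelve. all: by end_near. Qed.

(* Near [p], the maps are [S_a = S_b \o k] and [S_a' = S_b' \o k] with the same
   [k := S_b^-1 \o S_a], so the quotients of their Jacobians agree. *)
Lemma absdet_type (tau : M -> M) a b a' b' p q : Omega p -> Omega q ->
  (forall x, Omega x -> tau (word_map S a x) = word_map S a' x) ->
  (forall x, Omega x -> tau (word_map S b x) = word_map S b' x) ->
  word_map S a p = word_map S b q ->
  absdet g (word_map S a) p * absdet g (word_map S b') q =
  absdet g (word_map S a') p * absdet g (word_map S b) q.
Proof.
move=> Op Oq ta tb abE; have Up := W_sub (Omega_sub Op); have Uq := W_sub (Omega_sub Oq).
have [h [hx hd hn]] := word_map_inverse b Uq; rewrite -abE in hx hd hn.
have ad := word_map_mdiff S_cifs a Up.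
pose k := h \o word_map S a.
have kd : mdiff A k p := (mdiff_comp ad hd).1.
have kp : k p = q by [].
have near_a : \forall z \near p, (word_map S b \o k) z = word_map S a z.
  by apply: filterS (near_continuous ad.1 hn).
have near_a' : \forall z \near p, (word_map S b' \o k) z = word_map S a' z.
  have Ok : \forall z \near k p, Omega z by apply: open_nbhs_nbhs; rewrite kp.
  apply: filterS3 near_a (near_continuous kd.1 Ok) (open_nbhs_nbhs (conj Omega_open Op)).
  by move=> z /= bkz Okz Oz; rewrite -tb// bkz ta.
have bd b0 : mdiff A (word_map S b0) (k p).
  by rewrite kp; exact: word_map_mdiff S_cifs b0 _ Uq.
have cd b0 : mdiff A (word_map S b0 \o k) p := (mdiff_comp kd (bd b0)).1.
rewrite (near_absdet g near_a (cd b)) (near_absdet g near_a' (cd b')).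
rewrite (absdet_comp g kd (bd b)) (absdet_comp g kd (bd b')) kp.
by rewrite mulrAC [RHS]mulrAC; congr (_ * _); exact: mulrC.
Qed.

Lemma map_of_W u x : W x -> map_of W S u x = word_map S u x.
Proof. by move=> Wx; rewrite /map_of /on_W /patch mem_set. Qed.

Lemma map_of_cat u v : map_of W S (u ++ v) = on_W W (map_of W S u \o word_map S v).
Proof.
apply/funext => x; rewrite {1}/map_of /on_W /patch; case: ifP => // /set_mem Wx.
by rewrite /= map_of_W ?word_map_cat//; exact: word_map_W S_cifs v _ Wx.
Qed.

Lemma on_W_idem f : on_W W (on_W W f) = on_W W f.
Proof. by apply/funext => x; rewrite /on_W /patch; case: (x \in W). Qed.

Section Types.
Context (K : nat -> {fset (seq 'I_N)}).

(** The identity serves as [tau]. Each vertex thus lies in its own class, so equal classes give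
    equivalent vertices. *)
Lemma vertex_equiv_refl (t : (M -> M) * nat) : vertex_equiv W S Omega K t t.
Proof.
have fW f : neighbor_maps W S Omega K t f ->
    (forall x, W x -> W (f x)) /\ on_W W f = f.
  move=> [[u _ /= ->] _]; split; last exact: on_W_idem.
  by move=> x Wx; rewrite map_of_W//; exact: word_map_W S_cifs u _ Wx.
exists id; split=> //.
- by move=> _ [x [f /fW[fW' _] [y Wy <-]] <-]; exact: fW'.
- apply/seteqP; split=> [f Hf|_ [f Hf <-]]; last by rewrite (fW f Hf).2.
  by exists f => //; rewrite (fW f Hf).2.
- by move=> f f' Hf _ ->; rewrite [on_W W (id \o f)](fW f Hf).2.
Qed.

(** One representative [t0] is taken per class; its level is a finite set of words, and the maximum
    over finitely many classes bounds both the lengths and the number of these words. *)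
Lemma finite_types : finite_set [set vertex_class W S Omega K t | t in vertices W S K] ->
  exists c : nat, forall t, vertices W S K t -> exists t0 : (M -> M) * nat, [/\ vertices W S K t0,
    vertex_equiv W S Omega K t0 t, (max_len (K t0.2) <= c)%N & (size (K t0.2) <= c)%N].
Proof.
move=> fin; have [||c cP] := finite_uniform (Q := fun C c =>
  exists t0, [/\ vertices W S K t0, vertex_class W S Omega K t0 = C,
    (max_len (K t0.2) <= c)%N & (size (K t0.2) <= c)%N]) fin.
- move=> C c c' cc' [t0 [v0 wC H1 H2]]; exists t0.
  by split=> //; [exact: leq_trans H1 cc'|exact: leq_trans H2 cc'].
- move=> C [t vo <-]; exists (max_len (K t.2) + size (K t.2))%N, t.
  by rewrite leq_addr leq_addl.
exists c => t vo; have [|t0 [v0 wC H1 H2]] := cP (vertex_class W S Omega K t); first by exists t.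
exists t0; split=> //.
have : vertex_class W S Omega K t t by split=> //; exact: vertex_equiv_refl.
by rewrite -wC => -[].
Qed.

End Types.

Lemma absdet_word_bounds (m r : R) u x : 0 < m -> 0 < r ->
  (forall i x, W x -> m <= absdet g (S i) x <= r) -> W x ->
  m ^+ size u <= absdet g (word_map S u) x <= r ^+ size u.
Proof.
move=> m0 r0 mr Wx; elim: u => [|i u /andP[IH1 IH2]]; first by rewrite absdet_id !expr0 lexx.
rewrite (absdet_cons S_cifs i u (W_sub Wx)) !exprS.
have /andP[H1 H2] := mr i _ (word_map_W S_cifs u Wx).
have a0 := absdet_word_gt0 S_cifs u (W_sub Wx).
have /andP[b0 _] := cifs_absdet S_cifs i (word_map_U S_cifs u (W_sub Wx)).
apply/andP; split; apply: ler_pM => //; rewrite ?exprn_ge0 //; exact: ltW.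
Qed.

Lemma cifs_dim i x : U x -> (0 < n)%N.
Proof.
move=> Ux; rewrite lt0n; apply/eqP => n0.
have nV : n%:R^-1 = 0 :> R by rewrite n0 invr0.
by have [/andP[_ +] _] := cifs_stretch S_cifs i Ux; rewrite /stretch nV powRr0 ltxx.
Qed.

Lemma root_exprK (c : R) : (0 < n)%N -> 0 <= c -> (c `^ n%:R^-1) ^+ n = c.
Proof.
by move=> n0 c0; rewrite -powR_mulrn ?powR_ge0// -powRrM mulVf ?pnatr_eq0 -?lt0n// powRr1.
Qed.

Lemma absdet_le_ratio i u x (c : R) : W x -> ratio g W S (i :: u) <= c ->
  absdet g (word_map S (i :: u)) x <= c ^+ n.
Proof.
move=> Wx uc; have n0 := cifs_dim i (W_sub Wx).
have a0 v y : W y -> 0 <= absdet g (word_map S v) y.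
  by move=> /W_sub Uy; exact/ltW/(absdet_word_gt0 S_cifs v Uy).
rewrite -(root_exprK n0 (a0 _ x Wx)).
have H : absdet g (word_map S (i :: u)) x `^ n%:R^-1 <= c.
  (* The set under the supremum is bounded because determinants of words are at most 1. *)
  apply: le_trans uc; apply: ub_le_sup; last by exists x.
  exists 1 => _ [y Wy <-]; have E1 : 1 `^ n%:R^-1 = 1 :> R by rewrite powR1.
  rewrite -[X in _ <= X]E1; apply: ge0_ler_powR; rewrite ?nnegrE ?invr_ge0 ?a0//.
  exact: absdet_word_le1 S_cifs (i :: u) _ (W_sub Wy).
by apply: lerXn2r; rewrite ?nnegrE ?powR_ge0//; apply: le_trans H; exact: powR_ge0.
Qed.

(** A number below the supremum is exceeded at some point of [W]; for the empty word the determinant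
    is 1 everywhere. The letter [i] yields [n > 0] by [cifs_dim]. *)
Lemma absdet_gt_ratio v (c : R) i : 0 < c -> c < ratio g W S v ->
  exists2 y, W y & c ^+ n < absdet g (word_map S v) y.
Proof.
have [x0 Ox0] := Omega_nonempty; have Wx0 := Omega_sub Ox0 => c0 cv.
have n0 := cifs_dim i (W_sub Wx0).
have a0 y : W y -> 0 <= absdet g (word_map S v) y.
  by move=> /W_sub Uy; exact/ltW/(absdet_word_gt0 S_cifs v Uy).
suff [y Wy H] : exists2 y, W y & c < absdet g (word_map S v) y `^ n%:R^-1.
  exists y => //; rewrite -(root_exprK n0 (a0 y Wy)).
  by rewrite ltr_pXn2r ?nnegrE ?powR_ge0// ltW.
case: v cv {a0} => [|j v] cv; first by exists x0 => //; rewrite absdet_id powR1.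
have [|_ [y Wy <-] H] := sup_gt _ cv; last by exists y.
by exists (absdet g (word_map S (j :: v)) x0 `^ n%:R^-1); exists x0.
Qed.

Lemma geometric_threshold (r d : R) : 0 < r < 1 -> 0 < d ->
  exists V, forall k, d <= r ^+ k -> (k <= V)%N.
Proof.
move=> /andP[r0 r1] d0.
have /cvgrPdist_lt/(_ d d0)[V _ VP] : (GRing.exp r @ \oo --> (0 : R)).
  by apply: cvg_expr; rewrite gtr0_norm.
exists V => k dk; rewrite leqNgt; apply/negP => /ltnW /VP.
by rewrite /= sub0r normrN ger0_norm ?exprn_ge0 ?(ltW r0)// ltNge dk.
Qed.

Lemma finite_types_wsc (K : nat -> {fset (seq 'I_N)}) : nested_index_sets K ->
  finite_set [set vertex_class W S Omega K o | o in vertices W S K] -> wsc g W S.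
Proof.
move=> K_nested fin; have [c cP] := finite_types fin.
have [L L0 LP] := nested_gap K_nested.
have [m [r [m0 m1 r01 mr]]] := cifs_absdet_bounds U_open W_compact W_sub S_cifs.
have [B B0 BP] := bounded_distortion M_hausdorff U_open U_connected W_compact W_sub S_cifs.
have /andP[r0 r1] := r01.
have bounds u x := absdet_word_bounds u (x := x) m0 r0 mr.
have mpos k : 0 < m ^+ k by rewrite exprn_gt0.
(* This is the lower bound for [r ^+ size v] reached at the end: [m / B] stems from the last letter
   and the distortion of [u], [m ^+ L] from the tail of [u1], [m ^+ c] from the representative of
   the type. *)
have d0 : 0 < m / B * m ^+ (L + c) by rewrite mulr_gt0// divr_gt0.
have [V VP] := geometric_threshold r01 d0.
have [G GP] : exists G, (`I_c `*` [set v : seq 'I_N | (size v <= V)%N] #<= `I_G)%card.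
  by apply/finite_set_leP; apply: finite_setX; [exact: finite_II|exact: finite_short_words].
exists G, Omega; split=> //.
  by have [y Oy] := Omega_nonempty; exists y; exact: open_nbhs_nbhs.
move=> b /andP[b0 b1] x Wx.
pose Q := [set u | words_at g W S b u /\ exists2 p, Omega p & word_map S u p = x].
have YQ f : maps_at g W S b f /\ (f @` Omega) x -> exists2 u, Q u & f = map_of W S u.
  move=> [[u ub <-] [p Op px]]; exists u => //; split=> //; exists p => //.
  by rewrite -(map_of_W u (Omega_sub Op)).
have [Q0|QN] := pselect (Q !=set0); last first.
  rewrite (_ : [set f | _] = set0) ?card_ge0//.
  by apply/seteqP; split=> // f /YQ[u Qu _]; case: QN; exists u.
have [i0 _] : exists i : 'I_N, True.
  by have [_ [[v [i _]] _]] := Q0; exists i.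
have Qsize u : Q u -> (0 < size u)%N by move=> [[v [i [-> _]]] _]; rewrite size_rcons.
(* All words of [Q] are cut at the level [k], and the tail of [u1] beyond it has length at most [L];
   [u1] is the reference word for all others. *)
have [k [Qcut [u1 [w1 [Qu1 w1K w1u1 gap]]]]] :=
  common_level K_nested Q0 Qsize (leq_ltn_trans (leq0n _) (ltn_ord i0)).
have /prefixP[v1 u1E] := w1u1.
have v1L : (size v1 <= L)%N.
  by have := gap L LP; rewrite u1E size_cat addKn.
have [[v1' [i1 [u1r /andP[u1b _]]]] [p1 Op1 p1x]] := Qu1.
set q := word_map S v1 p1.
have Oq : Omega q by exact: word_map_Omega.
have w1q : word_map S w1 q = x by rewrite -word_map_cat -u1E.
have w1_vertex : vertices W S K (map_of W S w1, k) by exists w1.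
have [[f0 k0] [[b0' b0K /= f0E] [tau [tau_inj _ tauW nbrs _]] maxc sizec]] := cP _ w1_vertex.
rewrite /= in b0K maxc sizec.
have tau_b y : W y -> tau (word_map S b0' y) = word_map S w1 y.
  by move=> Wy; have := tauW y Wy; rewrite /= f0E !map_of_W.
(* Every neighbor of the vertex of [w1] is [tau] composed with a map from the level [k0] of the
   representative. So [H] recovers each counted map from an index into that level and a tail. *)
pose F j := map_of W S (nth [::] (enum_fset (K k0)) j).
pose H (jv : nat * seq 'I_N) := on_W W (on_W W (tau \o F jv.1) \o word_map S jv.2).
apply: card_le_trans GP; apply: card_le_trans (card_image_le H _).
apply: subset_card_le => f /YQ[u Qu ->].
have [w [wK /prefixP[v uE] _]] := Qcut u Qu.
have [[u' [i [ur /andP[ub bu']]]] [p Op px]] := Qu.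
set p' := word_map S v p; have Op' : Omega p' by exact: word_map_Omega.
have wp' : word_map S w p' = x by rewrite -word_map_cat -uE.
have : neighbor_maps W S Omega K (map_of W S w1, k) (map_of W S w).
  split; first by exists w.
  exists x; split; [exists q => //=|exists p' => //].
    by rewrite map_of_W//; exact: Omega_sub.
  by rewrite map_of_W//; exact: Omega_sub.
rewrite nbrs => -[f1 [[a aK /= f1E] a_nbr] wE].
rewrite /= in aK; rewrite f1E in a_nbr wE.
have tau_a y : W y -> tau (word_map S a y) = word_map S w y.
  move=> Wy; have := congr1 (fun h => h y) wE.
  by rewrite /on_W /patch mem_set//= !map_of_W.
(* [tau] sends both points to [x] and is injective on the union of the neighbors of the
   representative. *)
have ab : word_map S a p' = word_map S b0' q.
  have in_union a0 y : neighbor_maps W S Omega K (f0, k0) (map_of W S a0) -> Omega y ->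
      (\bigcup_(f in neighbor_maps W S Omega K (f0, k0)) (f @` W)) (word_map S a0 y).
    move=> na Oy; exists (map_of W S a0) => //; exists y; first exact: Omega_sub.
    by rewrite map_of_W//; exact: Omega_sub.
  apply: tau_inj; rewrite ?inE.
  - by apply: in_union => //; split=> //; exists a.
  - apply: in_union => //; split; first by exists b0'.
    have [y Oy] := Omega_nonempty.
    by rewrite f0E; exists (map_of W S b0' y); split; exists y.
  by rewrite tau_a ?tau_b ?wp' ?w1q//; exact: Omega_sub.
have ratioE := absdet_type Op' Oq (fun y Oy => tau_a y (Omega_sub Oy))
   (fun y Oy => tau_b y (Omega_sub Oy)) ab.
exists (seq.index a (enum_fset (K k0)), v); last first.
  by rewrite uE map_of_cat -wE /H /F /= nth_index.
split=> /=; first by apply: leq_trans sizec; rewrite index_mem.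
apply: VP; have Wp := Omega_sub Op; have Wp' := Omega_sub Op'; have Wq := Omega_sub Oq.
have b0n : 0 < b ^+ n by rewrite exprn_gt0.
(* Chain rule for [u1 = w1 ++ v1], whose tail contributes at least [m ^+ L]. *)
have w1_upper : absdet g (word_map S w1) q * m ^+ L <= b ^+ n.
  have u1_le : absdet g (word_map S u1) p1 <= b ^+ n.
    have [j [u2 u1c]] : exists j u2, u1 = j :: u2.
      by case: (u1) (Qsize _ Qu1) => // j u2 _; exists j, u2.
    by rewrite u1c in u1b *; exact: absdet_le_ratio (Omega_sub Op1) u1b.
  apply: le_trans u1_le; rewrite u1E (absdet_cat S_cifs w1 v1 (W_sub (Omega_sub Op1))).
  rewrite ler_wpM2l ?(ltW (absdet_word_gt0 S_cifs w1 (W_sub Wq)))//.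
  have /andP[H1 _] := bounds v1 _ (Omega_sub Op1).
  by apply: le_trans H1; rewrite ler_wiXn2l// ltW.
(* In [ratioE] the words from the representative's level cost little: the determinant of [a] is at
   most 1 and that of [b0'] at least [m ^+ c]. *)
have w_upper : absdet g (word_map S w) p' * m ^+ c <= absdet g (word_map S w1) q.
  apply: le_trans (_ : absdet g (word_map S a) p' * absdet g (word_map S w1) q <= _).
    rewrite ratioE ler_wpM2l ?(ltW (absdet_word_gt0 S_cifs w (W_sub Wp')))//.
    have /andP[H1 _] := bounds b0' _ Wq.
    apply: le_trans H1; rewrite ler_wiXn2l ?(ltW m0)//.
    exact: leq_trans (size_le_max_len b0K) maxc.
  rewrite ler_piMl ?(ltW (absdet_word_gt0 S_cifs w1 (W_sub Wq)))//.
  exact: absdet_word_le1 S_cifs a _ (W_sub Wp').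
(* The determinant of the parent [u'] exceeds [b ^+ n] at some point of [W], so by distortion it is
   at least [b ^+ n / B] at the image of [p] under the last letter, which itself costs a factor
   [m]. *)
have u_lower : m / B * b ^+ n <= absdet g (word_map S u) p.
  have [y Wy yb] := absdet_gt_ratio i b0 bu'.
  rewrite ur -cats1 (absdet_cat S_cifs u' [:: i] (W_sub Wp)) mulrAC [leRHS]mulrC.
  have /andP[H1 _] := bounds [:: i] _ Wp; rewrite expr1 in H1.
  rewrite -mulrA; apply: ler_pM => //; rewrite ?(ltW m0)//.
    by rewrite divr_ge0// ltW.
  rewrite ler_pdivrMr// mulrC; apply: le_trans (ltW yb) _.
  exact: BP (word_map_W S_cifs [:: i] Wp).
have u_upper : absdet g (word_map S u) p <= absdet g (word_map S w) p' * r ^+ size v.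
  rewrite uE (absdet_cat S_cifs w v (W_sub Wp)).
  rewrite ler_wpM2l ?(ltW (absdet_word_gt0 S_cifs w (W_sub Wp')))//.
  by have /andP[] := bounds v _ Wp.
(* The four estimates chain to the desired inequality multiplied by [b ^+ n]; cancelling it makes
   the bound on [size v] independent of [b] and [x]. *)
rewrite -(ler_pM2l b0n) exprD.
have rv : 0 < r ^+ size v by rewrite exprn_gt0.
apply: le_trans (_ : absdet g (word_map S w) p' * r ^+ size v * (m ^+ L * m ^+ c) <= _).
  rewrite mulrCA mulrA ler_wpM2r ?(ltW (mulr_gt0 (mpos L) (mpos c)))//.
  exact: le_trans u_lower u_upper.
have -> : absdet g (word_map S w) p' * r ^+ size v * (m ^+ L * m ^+ c) =
    absdet g (word_map S w) p' * m ^+ c * m ^+ L * r ^+ size v.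
  by rewrite mulrAC (mulrC (m ^+ L)) mulrA.
rewrite ler_wpM2r ?(ltW rv)//; apply: le_trans w1_upper.
by rewrite ler_wpM2r ?(ltW (mpos L)).
Qed.

End FiniteTypeCounting.

Unset Implicit Arguments.
Theorem theorem1p4 (R : realType) (n : nat) (M : topologicalType)
    (A : smooth_atlas R n M) (g : riemannian_metric A)
    (M_hausdorff : hausdorff_space M) (M_countable : @second_countable M)
    (M_orientable : orientable A) (M_complete : complete_metric g)
    (M_ricci : nonneg_ricci g)
    (U W : set M) (U_open : open U) (U_connected : connected U)
    (W_compact : compact W) (W_sub : W `<=` U)
    (W_regular : closure (interior W) = W)
    (N : nat) (N_ge2 : (2 <= N)%N) (S : 'I_N -> M -> M)
    (S_cifs : cifs g U W S)
    (Omega : set M) (S_ftc : ftc W S Omega) :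
  wsc g W S.
Proof.
case: S_ftc => Omega_open Omega_nonempty Omega_sub Omega_invariant [K [K_nested fin]].
exact: (finite_types_wsc M_hausdorff U_open U_connected W_compact W_sub S_cifs
  Omega_open Omega_nonempty Omega_sub Omega_invariant K_nested fin).
Qed.
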